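(* For given $\Theta\in L^2(\Omega)$ and $u_D\in H^{\frac12}(\Gamma_D^u;\mathbb{R}^d)$, there exists a unique weak solution $u\in H^1(\Omega;\mathbb{R}^d)$ satisfying $$u\in V^u(u_D),\qquad \int_\Omega\sigma^*[u,\Theta]:e[v]\,dx=0\quad\text{for all }v\in V^u(0).$$ Furthermore, this solution $u$ is the unique minimizer of the variational problem $$u=\operatorname*{argmin}_{v\in V^u(u_D)}E_{el}^*(v,\Theta),\qquad\text{where } E_{el}^*(v,\Theta)=\frac12\int_\Omega\sigma^*[v,\Theta]:e^*[v,\Theta]\,dx .$$
   Context: $\Omega\subset\mathbb{R}^d$ ($d=2$ or $3$) is a bounded domain with boundary $\Gamma=\Gamma_D^u\cup\Gamma_N^u$, $\Gamma_D^u\cap\Gamma_N^u=\emptyset$, where the $(d-1)$-dimensional volume of $\Gamma_D^u$ is positive; the boundary is regular enough for the standard Sobolev trace theory and Korn's inequality to hold. $H^{\frac12}(\Gamma_D^u;\mathbb{R}^d)$ is the space of traces on $\Gamma_D^u$ of functions in $H^1(\Omega;\mathbb{R}^d)$, and $$V^u(u_D):=\{u\in H^1(\Omega;\mathbb{R}^d):\ u|_{\Gamma_D^u}=u_D\}.$$ Constants: Lam\'e constants $\mu>0$, $\lambda>-\frac{2\mu}{d}$; $a_L>0$; $\beta:=a_L(d\lambda+2\mu)$; reference temperature $\Theta_0>0$. Here $\Theta=\Theta(x)$ is a given temperature. Strain and stress: $e[u]_{ij}=\frac12(\partial_{x_j}u_i+\partial_{x_i}u_j)$; $\sigma[u]:=\lambda(\operatorname{div}u)I+2\mu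 e[u]$; $e^*[u,\Theta]:=e[u]-a_L(\Theta-\Theta_0)I$; $\sigma^*[u,\Theta]:=\sigma[u]-\beta(\Theta-\Theta_0)I$, with $I$ the $d\times d$ identity. $A:B=\sum_{i,j}A_{ij}B_{ij}$. *)

(* Defs.v *)
From HB Require Import structures.
From mathcomp Require Import all_boot all_order all_algebra.
From mathcomp Require Import all_classical all_reals all_analysis.

Set Implicit Arguments.
Unset Strict Implicit.
Unset Printing Implicit Defensive.

Import Order.TTheory GRing.Theory Num.Theory.
Import numFieldNormedType.Exports.

Local Open Scope classical_set_scope.
Local Open Scope ring_scope.

(* R^d is 'rV[R]_d; the library equips it with the product topology.
   Coverings in the two outer measures below are by Borel sets. *)
Definition borelRn (R : realType) (d : nat) :=
  g_sigma_algebraType (@open 'rV[R]_d).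

Section LebesgueRn.
Context (R : realType) (d : nat).

Definition box (a b : 'rV[R]_d) : set 'rV[R]_d :=
  [set x | forall i, a 0 i < x 0 i <= b 0 i].

(* +oo on sets that are not boxes *)
Definition box_volume (U : set (borelRn R d)) : \bar R :=
  if `[< U = set0 >] then 0%E else
  ereal_inf [set (\prod_i (ab.2 0 i - ab.1 0 i))%:E | ab in
    [set ab : 'rV[R]_d * 'rV[R]_d |
      (forall i, ab.1 0 i <= ab.2 0 i) /\ U = box ab.1 ab.2]].

Lemma box_volume0 : box_volume set0 = 0%E.
Proof. by rewrite /box_volume; case: asboolP. Qed.

Lemma box_volume_ge0 U : (0 <= box_volume U)%E.
Proof.
rewrite /box_volume; case: asboolP => // _.
apply: le_ereal_inf_tmp => _ [[a b] /= [ab _] <-].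
by rewrite lee_fin; apply: prodr_ge0 => i _; rewrite subr_ge0.
Qed.

Definition leb_outer : set 'rV[R]_d -> \bar R := mu_ext box_volume.

HB.instance Definition _ := isOuterMeasure.Build R 'rV[R]_d leb_outer
  (mu_ext0 box_volume0 box_volume_ge0) (mu_ext_ge0 box_volume_ge0)
  (le_mu_ext box_volume) (mu_ext_sigma_subadditive box_volume_ge0).

Definition lebesgueRn :
    {measure set (caratheodory_type leb_outer) -> \bar R} :=
  [the {outer_measure set 'rV[R]_d -> \bar R} of leb_outer]
    : set (caratheodory_type leb_outer) -> \bar R.

End LebesgueRn.

Section Hausdorff.
Context (R : realType) (d s : nat).

(* the library norm of 'rV[R]_d is the sup norm *)
Definition euclid_norm (x : 'rV[R]_d) : R := Num.sqrt (\sum_i x 0 i ^+ 2).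

Definition euclid_diam (U : set 'rV[R]_d) : \bar R :=
  ereal_sup [set (euclid_norm (xy.1 - xy.2))%:E | xy in U `*` U].

(* volume of the unit ball of R^k, by the recursion
   omega_(k+2) = 2 pi omega_k / (k + 2) *)
Fixpoint unit_ball_volume (k : nat) : R :=
  match k with
  | 0 => 1
  | 1 => 2
  | k'.+2 => 2 * pi / k%:R * unit_ball_volume k'
  end.

Definition hausdorff_cost (delta : R) (U : set (borelRn R d)) : \bar R :=
  if `[< U = set0 >] then 0%E
  else if (euclid_diam U <= delta%:E)%E
    then ((unit_ball_volume s / 2 ^+ s)%:E * euclid_diam U ^+ s)%E
    else +oo%E.

Lemma unit_ball_volume_ge0 k : 0 <= unit_ball_volume k.
Proof.
suff: 0 <= unit_ball_volume k /\ 0 <= unit_ball_volume k.+1 by case.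
elim: k => [|k [k0 k1]]; split => //; rewrite -/unit_ball_volume.
by rewrite mulr_ge0// divr_ge0// mulr_ge0// pi_ge0.
Qed.

Lemma hausdorff_cost0 delta : hausdorff_cost delta set0 = 0%E.
Proof. by rewrite /hausdorff_cost; case: asboolP. Qed.

Lemma hausdorff_cost_ge0 delta U : (0 <= hausdorff_cost delta U)%E.
Proof.
rewrite /hausdorff_cost; case: asboolP => // /eqP/set0P[x Ux].
case: ifP => // _; apply: mule_ge0.
  by rewrite lee_fin divr_ge0// unit_ball_volume_ge0.
apply: expe_ge0; apply: ereal_sup_ubound; exists (x, x) => //=.
rewrite subrr /euclid_norm big1 ?sqrtr0// => i _.
by rewrite mxE expr0n.
Qed.

Definition hausdorff_outer (A : set 'rV[R]_d) : \bar R :=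
  ereal_sup [set mu_ext (hausdorff_cost delta) A | delta in [set t | 0 < t]].

Let hausdorff_outer0 : hausdorff_outer set0 = 0%E.
Proof.
rewrite /hausdorff_outer [X in ereal_sup X](_ : _ = [set 0%E]) ?ereal_sup1//.
apply/seteqP; split => [_ [t _ <-]|_ ->] /=.
  by rewrite (mu_ext0 (hausdorff_cost0 t) (hausdorff_cost_ge0 t)).
exists 1 => //=.
by rewrite (mu_ext0 (hausdorff_cost0 1) (hausdorff_cost_ge0 1)).
Qed.

Let hausdorff_outer_ge0 A : (0 <= hausdorff_outer A)%E.
Proof.
apply: (le_trans (mu_ext_ge0 (hausdorff_cost_ge0 1) A)).
by apply: ereal_sup_ubound; exists 1 => /=.
Qed.

Let le_hausdorff_outer :
  {homo hausdorff_outer : A B / A `<=` B >-> (A <= B)%E}.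
Proof.
move=> A B AB; apply: ge_ereal_sup => _ [t t0 <-].
apply: (le_trans (le_mu_ext (hausdorff_cost t) AB)).
by apply: ereal_sup_ubound; exists t.
Qed.

Let hausdorff_outer_sigma_subadditive : sigma_subadditive hausdorff_outer.
Proof.
move=> F; apply: ge_ereal_sup => _ [t t0 <-].
apply: (le_trans (mu_ext_sigma_subadditive (hausdorff_cost_ge0 t) F)).
apply: lee_nneseries => n _; first by move=> *; exact: (mu_ext_ge0 (hausdorff_cost_ge0 t)).
by apply: ereal_sup_ubound; exists t.
Qed.

HB.instance Definition _ := isOuterMeasure.Build R 'rV[R]_d hausdorff_outer
  hausdorff_outer0 hausdorff_outer_ge0 le_hausdorff_outer
  hausdorff_outer_sigma_subadditive.

Definition hausdorff :
    {measure set (caratheodory_type hausdorff_outer) -> \bar R} :=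
  [the {outer_measure set 'rV[R]_d -> \bar R} of hausdorff_outer]
    : set (caratheodory_type hausdorff_outer) -> \bar R.

End Hausdorff.

Section Sobolev.
Context (R : realType) (d : nat).
Implicit Types (Omega : set 'rV[R]_d).

Definition L2 d' (T : measurableType d') (mu : {measure set T -> \bar R})
    (D : set T) (f : T -> R) : Prop :=
  measurable_fun D f /\ mu.-integrable D (fun x => (f x ^+ 2)%:E).

Definition partial (i : 'I_d) (f : 'rV[R]_d -> R) : 'rV[R]_d -> R :=
  fun x => 'D_(delta_mx 0 i) f x.

Fixpoint Ck (k : nat) (f : 'rV[R]_d -> R) : Prop :=
  continuous f /\
  match k with
  | 0 => True
  | k'.+1 => forall i, (forall x, derivable f x (delta_mx 0 i)) /\
                       Ck k' (partial i f)
  end.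

Definition smooth (f : 'rV[R]_d -> R) : Prop := forall k, Ck k f.

Definition test_function Omega (phi : 'rV[R]_d -> R) : Prop :=
  smooth phi /\
  exists K, [/\ compact K, K `<=` Omega & forall x, ~ K x -> phi x = 0].

Definition weak_partial Omega (i : 'I_d) (f g : 'rV[R]_d -> R) : Prop :=
  forall phi, test_function Omega phi ->
    \int[lebesgueRn R d]_(x in Omega) (f x * partial i phi x) =
    - \int[lebesgueRn R d]_(x in Omega) (g x * phi x).

(* An element of H^1(Omega) is carried by a representative together with its
   weak gradient, which it determines almost everywhere; accordingly, equality
   in H^1(Omega) is equality almost everywhere of representatives, not
   equality of records.  Values outside Omega are irrelevant. *)
Record H1 Omega := MkH1 {
  H1_val :> 'rV[R]_d -> R ;
  H1_grad : 'I_d -> 'rV[R]_d -> R ;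
  H1_val_L2 : L2 (lebesgueRn R d) Omega H1_val ;
  H1_grad_L2 : forall i, L2 (lebesgueRn R d) Omega (H1_grad i) ;
  H1_weak_partial : forall i, weak_partial Omega i H1_val (H1_grad i) }.

Definition H1_sqdist Omega (u v : H1 Omega) : R :=
  \int[lebesgueRn R d]_(x in Omega) ((u x - v x) ^+ 2) +
  \sum_i \int[lebesgueRn R d]_(x in Omega)
    ((H1_grad u i x - H1_grad v i x) ^+ 2).

Definition H1_sqnorm Omega (u : H1 Omega) : R :=
  \int[lebesgueRn R d]_(x in Omega) (u x ^+ 2) +
  \sum_i \int[lebesgueRn R d]_(x in Omega) (H1_grad u i x ^+ 2).

(* the (d-1)-dimensional volume *)
Definition surface := @hausdorff R d d.-1.

Definition boundary Omega : set 'rV[R]_d := closure Omega `\` interior Omega.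

(* gamma is the trace operator of Omega: the bounded linear map from
   H^1(Omega) to L^2(boundary) extending the restriction of functions that are
   continuous up to the boundary.  The density clause makes it unique (up to
   equality almost everywhere). *)
Record trace_operator Omega (gamma : ('rV[R]_d -> R) -> 'rV[R]_d -> R) : Prop :=
  MkTraceOperator {
  trace_L2 : forall u : H1 Omega, L2 surface (boundary Omega) (gamma u) ;
  trace_linear : forall (a : R) (u v : H1 Omega),
    {ae surface, forall x, boundary Omega x ->
      gamma (fun y => a * u y + v y) x = a * gamma u x + gamma v x} ;
  trace_bounded : exists C : R, forall u : H1 Omega,
    \int[surface]_(x in boundary Omega) (gamma u x ^+ 2) <= C * H1_sqnorm u ;
  trace_restriction : forall u : H1 Omega,
    {within closure Omega, continuous u} ->
    {ae surface, forall x, boundary Omega x -> gamma u x = u x} ;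
  trace_density : forall (u : H1 Omega) (e : R), 0 < e ->
    exists phi : H1 Omega, smooth phi /\ H1_sqdist u phi < e }.

End Sobolev.

Section Elasticity.
Context (R : realType) (d : nat) (Omega : set 'rV[R]_d).
Context (gamma : ('rV[R]_d -> R) -> 'rV[R]_d -> R).
Implicit Types (u v : 'I_d -> H1 Omega) (G : set 'rV[R]_d).
Implicit Types (uD : 'I_d -> 'rV[R]_d -> R) (Theta : 'rV[R]_d -> R).

Definition H1_eq u v : Prop :=
  forall i, {ae lebesgueRn R d, forall x, Omega x -> u i x = v i x}.

Definition V G uD u : Prop :=
  forall i, {ae surface R d, forall x, G x -> gamma (u i) x = uD i x}.

(* uD belongs to H^(1/2)(G; R^d) *)
Definition trace_space G uD : Prop := exists w, V G uD w.

Definition ddot (A B : 'M[R]_d) : R := \sum_i \sum_j A i j * B i j.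

Definition divergence u (x : 'rV[R]_d) : R := \sum_i H1_grad (u i) i x.

Definition strain u (x : 'rV[R]_d) : 'M[R]_d :=
  \matrix_(i, j) (2^-1 * (H1_grad (u i) j x + H1_grad (u j) i x)).

Definition stress (lambda mu : R) u (x : 'rV[R]_d) : 'M[R]_d :=
  (lambda * divergence u x) *: 1%:M + (2 * mu) *: strain u x.

Definition beta (lambda mu aL : R) : R := aL * (d%:R * lambda + 2 * mu).

Definition thermal_strain (aL Theta0 : R) Theta u (x : 'rV[R]_d) : 'M[R]_d :=
  strain u x - (aL * (Theta x - Theta0)) *: 1%:M.

Definition thermal_stress (lambda mu aL Theta0 : R) Theta u (x : 'rV[R]_d) :
    'M[R]_d :=
  stress lambda mu u x - (beta lambda mu aL * (Theta x - Theta0)) *: 1%:M.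

Definition weak_solution (lambda mu aL Theta0 : R) G uD Theta u : Prop :=
  V G uD u /\
  forall v, V G (fun _ _ => 0) v ->
    \int[lebesgueRn R d]_(x in Omega)
      ddot (thermal_stress lambda mu aL Theta0 Theta u x) (strain v x) = 0.

Definition elastic_energy (lambda mu aL Theta0 : R) Theta u : R :=
  2^-1 * \int[lebesgueRn R d]_(x in Omega)
    ddot (thermal_stress lambda mu aL Theta0 Theta u x)
         (thermal_strain aL Theta0 Theta u x).

Definition minimizer (lambda mu aL Theta0 : R) G uD Theta u : Prop :=
  V G uD u /\
  forall v, V G uD v ->
    elastic_energy lambda mu aL Theta0 Theta u <=
    elastic_energy lambda mu aL Theta0 Theta v.

(* Korn's inequality for fields vanishing on a part of the boundary of positive
   (d-1)-dimensional volume, as it holds on bounded Lipschitz domains. *)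
Definition korn : Prop :=
  forall G, G `<=` boundary Omega ->
    measurable (G : set (caratheodory_type (hausdorff_outer d.-1))) ->
    (0 < surface R d G)%E ->
    exists C : R, forall v, V G (fun _ _ => 0) v ->
      \sum_i H1_sqnorm (v i) <=
      C * \int[lebesgueRn R d]_(x in Omega) ddot (strain v x) (strain v x).

End Elasticity.

(* Main.v *)
Require Import Defs.
From HB Require Import structures.
From mathcomp Require Import all_boot all_order all_algebra.
From mathcomp Require Import all_classical all_reals all_analysis.
From mathcomp Require Import measurable_realfun ring lra.

Set Implicit Arguments.
Unset Strict Implicit.
Unset Printing Implicit Defensive.

Import Order.TTheory GRing.Theory Num.Theory.
Import numFieldNormedType.Exports.

Local Open Scope classical_set_scope.
Local Open Scope ring_scope.

(** The thermal stress is the image of the thermal strain under Hooke's law,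
    exactly because beta = aL (d lambda + 2 mu).  Writing B for the bilinear form
    that integrates Hooke's law applied to one matrix field against another, the
    energy of u is therefore B(e*[u], e*[u]) / 2, and the weak equation reads
    B(e*[u], e[v]) = 0 for all v in V(0).  Both statements become facts about the
    form a(u, v) = B(e[u], e[v]) on the space V(0) of fields with vanishing trace
    on GammaD.

    The form a is bounded for the H^1 norm (strain_form_bounded).  It is coercive on
    V(0): Hooke's law is elliptic because lambda > - 2 mu / d (hooke_elliptic), and
    Korn's inequality bounds the H^1 norm by the strain (H1_sqnorm_le_strain_form).
    Hence V(0) is complete for a (V0_complete), since H^1 is complete
    (H1_complete) and bounded traces make V(0) closed (trace0_closed).  Fix an
    extension w of the boundary datum.  The Riesz representation theorem
    (riesz_representation) gives v in V(0) with a(v, .) = - B(e*[w], e[.]), and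
    u = w + v is a weak solution.

    For phi in V(0) the energy expands as E(u + phi) = E(u) + a(phi, phi) / 2
    (elastic_energy_add), so u is a minimizer, and any other minimizer, as well
    as any other weak solution, differs from u by some phi in V(0) with
    a(phi, phi) <= 0, which coercivity forces to vanish almost everywhere
    (strain_form_eq0).

    The completeness of L^2 (L2_complete) is Riesz and Fischer's argument.  That open
    sets are measurable for the Lebesgue measure, which is built from an outer
    measure by Caratheodory's construction, follows from cutting boxes by
    coordinate half-spaces (lebesgue_measurable_open).  The elements of H^1 are
    representatives that carry their weak gradient, so they form a vector space
    on which the H^1 norm is only a seminorm. *)

(** * Measurability for the Lebesgue measure of R^d *)

Section LebesgueMeasurability.
Context (R : realType) (d : nat).
Implicit Types (a b x : 'rV[R]_d) (U : set 'rV[R]_d).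

Lemma box_volume_le a b : (forall i, a 0 i <= b 0 i) ->
  (box_volume (box a b) <= (\prod_i (b 0 i - a 0 i))%:E)%E.
Proof.
move=> ab; rewrite /box_volume; case: asboolP => [_|_].
  by rewrite lee_fin; apply: prodr_ge0 => i _; rewrite subr_ge0.
by apply: ereal_inf_lbound; exists (a, b).
Qed.

Lemma continuous_coord (i : 'I_d) : continuous (fun x : 'rV[R]_d => x 0 i).
Proof. by move=> x; exact: coord_continuous. Qed.

Lemma borel_le_coord (i : 'I_d) (c : R) :
  measurable ([set x | x 0 i <= c] : set (borelRn R d)).
Proof.
rewrite -[X in measurable X]setCK; apply: measurableC; apply: sub_sigma_algebra.
have -> : ~` [set x : 'rV[R]_d | x 0 i <= c] =
    (fun x : 'rV[R]_d => x 0 i) @^-1` [set y | c < y].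
  by apply/seteqP; split => x /=; rewrite ltNge => /negP.
by apply: open_comp (@open_gt _ c) => x _; exact: continuous_coord.
Qed.

Lemma boxE a b : box a b = \bigcap_(i in [set: 'I_d])
  ([set x | x 0 i <= b 0 i] `&` ~` [set x | x 0 i <= a 0 i]).
Proof.
apply/seteqP; split => [x abx i _ | x abx i].
  by have /andP[ai ib] := abx i; split => //=; apply/negP; rewrite -ltNge.
by have [/= -> /negP] := abx i I; rewrite -ltNge => ->.
Qed.

Lemma borel_box a b : measurable (box a b : set (borelRn R d)).
Proof.
rewrite boxE; apply: fin_bigcap_measurable; first exact: finite_finset.
move=> i _; apply: measurableI; first exact: borel_le_coord.
by apply: measurableC; exact: borel_le_coord.
Qed.

(** The half-space cuts a box into two boxes whose volumes add up: the side
    ]a_i, b_i] is cut at c clamped to [a_i, b_i]. *)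
Lemma box_volume_split (i : 'I_d) (c : R) (U : set (borelRn R d)) :
  (box_volume (U `&` [set x | x 0%R i <= c]%R) +
   box_volume (U `&` ~` [set x | x 0%R i <= c]%R) <= box_volume U)%E.
Proof.
have [->|U0] := eqVneq U set0.
  by rewrite !set0I box_volume0 adde0.
rewrite {3}/box_volume; case: asboolP => [U00|_]; first by rewrite U00 eqxx in U0.
apply: le_ereal_inf_tmp => _ [[a b] /= [ab UE] <-].
pose c' := Num.max (a 0 i) (Num.min (b 0 i) c).
have ac' : a 0 i <= c' by rewrite le_max lexx.
have c'b : c' <= b 0 i by rewrite ge_max ab ge_min lexx.
pose b' : 'rV[R]_d := \row_j (if j == i then c' else b 0 j).
pose a' : 'rV[R]_d := \row_j (if j == i then c' else a 0 j).
have Ule : U `&` [set x | x 0 i <= c] = box a b'.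
  rewrite UE; apply/seteqP; split => [x [abx /= xc] j|x abx]; last split => [j|/=].
  - rewrite mxE; have /andP[aj bj] := abx j; rewrite aj /=.
    have [ji|//] := eqVneq j i.
    by subst j; rewrite /c' le_max le_min bj xc orbT.
  - have /andP[-> ] := abx j; rewrite mxE; have [->|//] := eqVneq j i.
    by move=> /le_trans; apply.
  - have := abx i; rewrite mxE eqxx => /andP[ax].
    rewrite le_max leNgt ax /= le_min => /andP[_ ->] //.
have Ugt : U `&` ~` [set x | x 0 i <= c] = box a' b.
  rewrite UE; apply/seteqP; split => [x [abx /= xc] j|x abx]; last split => [j|/=].
  - rewrite mxE; have /andP[aj bj] := abx j; rewrite bj andbT.
    have [ji|//] := eqVneq j i.
    by subst j; rewrite /c' gt_max aj gt_min (ltNge c); move/negP: xc => ->; rewrite orbT.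
  - have /andP[] := abx j; rewrite mxE => + ->; rewrite andbT; have [->|//] := eqVneq j i.
    by move=> /(le_lt_trans ac').
  - have := abx i; rewrite mxE eqxx => /andP[+ xb].
    by rewrite /c' gt_max gt_min (ltNge (b 0 i)) xb /= => /andP[_]; rewrite ltNge => /negP.
rewrite Ule Ugt; apply: (le_trans (leeD (box_volume_le _) (box_volume_le _))).
- by move=> j; rewrite mxE; case: eqVneq => [->|].
- by move=> j; rewrite mxE; case: eqVneq => [->|].
rewrite -EFinD lee_fin (bigD1 i) //= [X in _ + X](bigD1 i) //= [leRHS](bigD1 i) //=.
rewrite !mxE eqxx (eq_bigr (fun j => b 0 j - a 0 j)); last first.
  by move=> j /negPf ji; rewrite mxE ji.
rewrite [X in _ + _ * X](eq_bigr (fun j => b 0 j - a 0 j)); last first.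
  by move=> j /negPf ji; rewrite mxE ji.
by rewrite -mulrDl addrC addrA subrK.
Qed.

Notation lebT := (caratheodory_type (@leb_outer R d)).

(** Subadditivity is tested on coverings, so Caratheodory's criterion reduces to
    the sets allowed in the coverings that define the outer measure. *)
Lemma lebesgue_measurable_cut (H : set 'rV[R]_d) :
  measurable (H : set (borelRn R d)) ->
  (forall U : set (borelRn R d),
    (box_volume (U `&` H) + box_volume (U `&` ~` H) <= box_volume U)%E) ->
  measurable (H : set lebT).
Proof.
move=> mH cutH; apply: le_caratheodory_measurable => X /=.
rewrite {3}/leb_outer /mu_ext; apply: le_ereal_inf_tmp => _ [F [mF XF] <-].
apply: (@le_trans _ _ (\sum_(k <oo) box_volume (F k `&` H) +
                       \sum_(k <oo) box_volume (F k `&` ~` H))%E).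
  apply: leeD; apply: ereal_inf_lbound.
    exists (fun k => F k `&` H) => //; split => [k|]; first exact: measurableI.
    by rewrite -setI_bigcupl; exact: setSI.
  exists (fun k => F k `&` ~` H) => //; split => [k|].
    by apply: measurableI => //; exact: measurableC.
  by rewrite -setI_bigcupl; exact: setSI.
rewrite -nneseriesD; last 2 first.
- by move=> *; exact: box_volume_ge0.
- by move=> *; exact: box_volume_ge0.
apply: lee_nneseries => k _; first by move=> *; rewrite adde_ge0 ?box_volume_ge0.
exact: cutH.
Qed.

Lemma lebesgue_measurable_le_coord (i : 'I_d) (c : R) :
  measurable ([set x | x 0 i <= c] : set lebT).
Proof.
by apply: lebesgue_measurable_cut; [exact: borel_le_coord|exact: box_volume_split].
Qed.

Lemma lebesgue_measurable_box a b : measurable (box a b : set lebT).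
Proof.
rewrite boxE; apply: fin_bigcap_measurable; first exact: finite_finset.
move=> i _; apply: measurableI; first exact: lebesgue_measurable_le_coord.
by apply: measurableC; exact: lebesgue_measurable_le_coord.
Qed.

(** An open set is the union of the countably many boxes with rational corners
    that it contains. *)
Lemma lebesgue_measurable_open U : open U -> measurable (U : set lebT).
Proof.
move=> oU.
pose ratr_row (q : 'rV[rat]_d) : 'rV[R]_d := map_mx ratr q.
pose B (n : nat) : set 'rV[R]_d :=
  if unpickle n is Some (p, q) then
    if `[< box (ratr_row p) (ratr_row q) `<=` U >] then box (ratr_row p) (ratr_row q)
    else set0
  else set0.
have -> : U = \bigcup_n B n.
  apply/seteqP; split => [x Ux|x [n _]]; last first.
    by rewrite /B; case: unpickle => [[p q]|//]; case: asboolP => // + xpq; apply.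
  have /nbhs_ballP[e /= e0 xeU] : nbhs x U by exact: open_nbhs_nbhs.
  have [p px] : {p : 'rV[rat]_d | forall i, x 0 i - e < ratr (p 0 i) < x 0 i}.
    have /choice[p pP] : forall i, exists q : rat, x 0 i - e < ratr q < x 0 i.
      move=> i; have [|q] := @rat_in_itvoo _ (x 0 i - e) (x 0 i); first lra.
      by rewrite in_itv /=; exists q.
    by exists (\row_i p i) => i; rewrite mxE.
  have [q qx] : {q : 'rV[rat]_d | forall i, x 0 i < ratr (q 0 i) < x 0 i + e}.
    have /choice[q qP] : forall i, exists q : rat, x 0 i < ratr q < x 0 i + e.
      move=> i; have [|q] := @rat_in_itvoo _ (x 0 i) (x 0 i + e); first lra.
      by rewrite in_itv /=; exists q.
    by exists (\row_i q i) => i; rewrite mxE.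
  exists (pickle (p, q)) => //; rewrite /B pickleK; case: asboolP => [_ i|[]].
    rewrite !mxE; have /andP[_ ->] := px i.
    by have /andP[/ltW -> _] := qx i.
  move=> y pqy; apply: xeU; split => // i j; rewrite (ord1 i) /ball /= ltr_norml.
  have := pqy j; rewrite !mxE; have := px j; have := qx j.
  by move=> /andP[? ?] /andP[? ?] /andP[? ?]; lra.
apply: bigcup_measurable => n _; rewrite /B.
case: unpickle => [[p q]|]; last exact: measurable0.
by case: asboolP => _; [exact: lebesgue_measurable_box|exact: measurable0].
Qed.

Lemma lebesgue_bounded_lty U : bounded_set U -> (lebesgueRn R d U < +oo)%E.
Proof.
move=> [M0 [_ /(_ (M0 + 1))]]; set M := M0 + 1 => MU0.
have {MU0}MU x : U x -> `|x| <= M by move=> Ux; apply: MU0 => //; rewrite ltrDl.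
pose a : 'rV[R]_d := const_mx (- M - 1).
pose b : 'rV[R]_d := const_mx (M + 1).
have Uab : U `<=` box a b.
  move=> x Ux i; rewrite !mxE.
  have : `|x 0 i| <= M.
    apply: le_trans (MU x Ux).
    by rewrite [leRHS]/Num.Def.normr /= mx_normrE; apply: le_bigmax (0 , i).
  by rewrite ler_norml => /andP[? ?]; lra.
apply: (@le_lt_trans _ _ (box_volume (box a b))); last first.
  have [->|/set0P[x abx]] := eqVneq (box a b) set0; first by rewrite box_volume0 ltry.
  apply: le_lt_trans (box_volume_le _) _; last exact: ltry.
  by move=> i; have /andP[/ltW ax xb] := abx i; exact: le_trans xb.
apply: ereal_inf_lbound; exists (fun k : nat => if k == 0%N then box a b else set0).
  split => [[|k]|x /Uab abx]; [exact: borel_box|exact: measurable0|by exists 0%N].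
rewrite (nneseries_split 0 1)//; last by move=> *; exact: box_volume_ge0.
rewrite add0n big_nat1 eseries0 ?adde0//.
by move=> [|k] //= _ _; exact: box_volume0.
Qed.

Lemma continuous_lebesgue_measurable (D : set lebT) (f : 'rV[R]_d -> R) :
  measurable D -> continuous f -> measurable_fun D f.
Proof.
move=> mD cf; apply: (measurability _ (RGenOpens.measurableE R)).
move=> _ [_ [a [b ->]] <-].
apply: measurableI => //; apply: lebesgue_measurable_open.
by apply: open_comp => [x _|]; [exact: cf|exact: interval_open].
Qed.

End LebesgueMeasurability.
(** * Square integrable functions *)

(** The discriminant of a quadratic polynomial in t that stays nonnegative.
    Every Cauchy--Schwarz inequality below is an instance, and so is the estimate
    of the first variation of a nearly minimal value. *)
Lemma sqr_le_of_quadratic_ge0 (R : realFieldType) (p q r : R) :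
  (forall t, 0 <= p + 2 * t * q + t ^+ 2 * r) -> q ^+ 2 <= p * r.
Proof.
move=> P; have p0 : 0 <= p by have := P 0; rewrite mulr0 mul0r expr0n mul0r !addr0.
have [r0|r0|r0] := ltgtP r 0.
- (* large opposite arguments make a concave quadratic negative *)
  pose u := 1 - p / r.
  have ur : u * r = r - p by rewrite /u; field; rewrite lt_eqF.
  have u1 : 1 <= u by rewrite lerDl -mulrN mulr_ge0// oppr_ge0 invr_le0 ltW.
  have uur : u ^+ 2 * r <= r - p by rewrite -ur expr2 -mulrA; nra.
  by have := P u; have := P (- u); rewrite sqrrN; nra.
- have := P (- q / r).
  have -> : p + 2 * (- q / r) * q + (- q / r) ^+ 2 * r = p - q ^+ 2 / r.
    by field; rewrite gt_eqF.
  by rewrite subr_ge0 ler_pdivrMr.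
- (* the polynomial is affine: this t gives it the value -1 unless q = 0 *)
  rewrite r0 mulr0; have [->|q0] := eqVneq q 0; first by rewrite expr0n.
  have := P (- (1 + p) / (2 * q)).
  have -> : p + 2 * (- (1 + p) / (2 * q)) * q + (- (1 + p) / (2 * q)) ^+ 2 * r = -1.
    by rewrite r0 mulr0; field.
  by rewrite ler0N1.
Qed.

Section L2Space.
Context d' (T : measurableType d') (R : realType).
Context (mu : {measure set T -> \bar R}) (D : set T) (mD : measurable D).
Implicit Types f g h : T -> R.

Lemma L2_integrableM f g : L2 mu D f -> L2 mu D g ->
  mu.-integrable D (EFin \o (fun x => f x * g x)).
Proof.
move=> [mf f2] [mg g2].
apply: (le_integrable mD _ _ (integrableD mD f2 g2)).
  by apply/measurable_EFinP; exact: measurable_funM.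
move=> x _ /=; rewrite lee_fin; apply: (le_trans _ (ler_norm _)).
rewrite ler_norml; nra.
Qed.

Lemma L2_integrable_sqr f : L2 mu D f ->
  mu.-integrable D (EFin \o (fun x => f x ^+ 2)).
Proof. by case. Qed.

Lemma integrableZD (a : R) f g :
  mu.-integrable D (EFin \o f) -> mu.-integrable D (EFin \o g) ->
  mu.-integrable D (EFin \o (fun x => a * f x + g x)).
Proof. by move=> fi gi; have := integrableD mD (integrableZl mD a fi) gi. Qed.

Lemma RintegralZDl (a : R) f g :
  mu.-integrable D (EFin \o f) -> mu.-integrable D (EFin \o g) ->
  \int[mu]_(x in D) (a * f x + g x) =
  a * \int[mu]_(x in D) f x + \int[mu]_(x in D) g x.
Proof.
move=> fi gi; rewrite RintegralD//; last exact: (integrableZl mD a fi).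
by rewrite RintegralZl.
Qed.

Lemma integrable_big (I : Type) (r : seq I) (F : I -> T -> R) :
  (forall i, mu.-integrable D (EFin \o F i)) ->
  mu.-integrable D (EFin \o (fun x => \sum_(i <- r) F i x)).
Proof.
move=> iF; rewrite (_ : _ \o _ = (fun x => \sum_(i <- r) (F i x)%:E)%E).
  by apply: integrable_sum => // i _; exact: iF.
by apply/funext => x /=; rewrite sumEFin.
Qed.

Lemma Rintegral_big (I : Type) (r : seq I) (F : I -> T -> R) :
  (forall i, mu.-integrable D (EFin \o F i)) ->
  \int[mu]_(x in D) (\sum_(i <- r) F i x) = \sum_(i <- r) \int[mu]_(x in D) F i x.
Proof.
move=> iF; elim: r => [|i r IH].
  rewrite big_nil (@eq_Rintegral _ _ _ _ _ (cst 0)) => [|x _]; last by rewrite big_nil.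
  by rewrite Rintegral_cst// mul0r.
rewrite big_cons -IH -RintegralD//; last exact: integrable_big.
by apply: eq_Rintegral => x _; rewrite big_cons.
Qed.

Lemma L2_ZD (a : R) f g : L2 mu D f -> L2 mu D g -> L2 mu D (fun x => a * f x + g x).
Proof.
move=> f2 g2; have [mf _] := f2; have [mg _] := g2; split.
  by apply: measurable_funD => //; exact: measurable_funM.
have -> : (fun x => ((a * f x + g x) ^+ 2)%:E) = EFin \o (fun x =>
    a ^+ 2 * f x ^+ 2 + (2 * a * (f x * g x) + g x ^+ 2)).
  by apply/funext => x /=; congr EFin; ring.
apply: integrableZD; first exact: L2_integrable_sqr.
by apply: integrableZD; [exact: L2_integrableM|exact: L2_integrable_sqr].
Qed.

Lemma L2_cst0 : L2 mu D (cst 0).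
Proof.
split; first exact: measurable_cst.
have -> : (fun x : T => ((cst 0 x : R) ^+ 2)%:E) = cst 0%E.
  by apply/funext => x /=; rewrite expr0n.
exact: integrable0.
Qed.

Lemma L2Z (a : R) f : L2 mu D f -> L2 mu D (fun x => a * f x).
Proof.
move=> /(@L2_ZD a _ (cst 0))/(_ L2_cst0).
by under eq_fun do rewrite addr0.
Qed.

Lemma L2D f g : L2 mu D f -> L2 mu D g -> L2 mu D (fun x => f x + g x).
Proof. by move=> /(@L2_ZD 1 _ g)/[apply]; under eq_fun do rewrite mul1r. Qed.

Lemma L2B f g : L2 mu D f -> L2 mu D g -> L2 mu D (fun x => f x - g x).
Proof.
by move=> f2 /(@L2_ZD (-1) _ f)/(_ f2); under eq_fun do rewrite mulN1r addrC.
Qed.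

Lemma L2_sum (I : Type) (r : seq I) (F : I -> T -> R) :
  (forall i, L2 mu D (F i)) -> L2 mu D (fun x => \sum_(i <- r) F i x).
Proof.
move=> F2; elim: r => [|i r IH]; first by under eq_fun do rewrite big_nil; exact: L2_cst0.
by under eq_fun do rewrite big_cons; exact: L2D.
Qed.

Lemma L2_pairing_ZD (a : R) f g h : L2 mu D f -> L2 mu D g -> L2 mu D h ->
  \int[mu]_(x in D) ((a * f x + g x) * h x) =
  a * \int[mu]_(x in D) (f x * h x) + \int[mu]_(x in D) (g x * h x).
Proof.
move=> f2 g2 h2; rewrite -RintegralZDl; do ?exact: L2_integrableM.
by apply: eq_Rintegral => x _; ring.
Qed.

Lemma L2_pairing_B f g h : L2 mu D f -> L2 mu D g -> L2 mu D h ->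
  \int[mu]_(x in D) ((f x - g x) * h x) =
  \int[mu]_(x in D) (f x * h x) - \int[mu]_(x in D) (g x * h x).
Proof.
move=> f2 g2 h2; rewrite -RintegralB; do ?exact: L2_integrableM; last by [].
by apply: eq_Rintegral => x _; ring.
Qed.

Lemma L2_cauchy_schwarz f g : L2 mu D f -> L2 mu D g ->
  (\int[mu]_(x in D) (f x * g x)) ^+ 2 <=
  \int[mu]_(x in D) (f x ^+ 2) * \int[mu]_(x in D) (g x ^+ 2).
Proof.
move=> f2 g2; apply: sqr_le_of_quadratic_ge0 => t.
have := @Rintegral_ge0 _ _ _ mu D (fun x => (t * g x + f x) ^+ 2).
move=> /(_ (fun x _ => sqr_ge0 _)).
have -> : \int[mu]_(x in D) ((t * g x + f x) ^+ 2) = \int[mu]_(x in D)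
    (t ^+ 2 * g x ^+ 2 + (2 * t * (f x * g x) + f x ^+ 2)).
  by apply: eq_Rintegral => x _; ring.
rewrite !RintegralZDl//; do ?[exact: L2_integrable_sqr|exact: L2_integrableM].
  by move=> /le_trans; apply; rewrite le_eqVlt; apply/orP; left; apply/eqP; ring.
by apply: integrableZD; [exact: L2_integrableM|exact: L2_integrable_sqr].
Qed.

Lemma L2_ae_eq f g : L2 mu D f -> L2 mu D g ->
  {ae mu, forall x, D x -> f x ^+ 2 = g x ^+ 2} ->
  \int[mu]_(x in D) (f x ^+ 2) = \int[mu]_(x in D) (g x ^+ 2).
Proof.
move=> /L2_integrable_sqr f2 /L2_integrable_sqr g2 fg; congr fine.
apply: ae_eq_integral; first exact: mD.
- by case/integrableP : f2.
- by case/integrableP : g2.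
- by apply: filterS fg => x fgx /fgx /= ->.
Qed.

Lemma L2_subset (G : set T) f : measurable G -> G `<=` D -> L2 mu D f -> L2 mu G f.
Proof.
by move=> mG GD [mf f2]; split; [exact: measurable_funS mf|exact: integrableS f2].
Qed.

Lemma L2_le_subset (G : set T) f : measurable G -> G `<=` D -> L2 mu D f ->
  \int[mu]_(x in G) (f x ^+ 2) <= \int[mu]_(x in D) (f x ^+ 2).
Proof.
move=> mG GD f2; have [_ fG] := L2_subset mG GD f2; case: f2 => _ fD.
apply: fine_le; [exact: integrable_fin_num|exact: integrable_fin_num|].
apply: ge0_subset_integral => //; first by case/integrableP : fD.
by move=> x _; rewrite lee_fin sqr_ge0.
Qed.

Lemma L2_ae0 f : L2 mu D f -> \int[mu]_(x in D) (f x ^+ 2) = 0 ->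
  {ae mu, forall x, D x -> f x = 0}.
Proof.
move=> f2 I0; have [mf fi] := f2.
have mf2 : measurable_fun D (fun x => (f x ^+ 2)%:E) by case/integrableP : fi.
have : (\int[mu]_(x in D) `|(f x ^+ 2)%:E| = 0)%E.
  rewrite -[RHS]/(0%:E) -I0 /Rintegral fineK; last exact: integrable_fin_num.
  by apply: eq_integral => x _; rewrite gee0_abs// lee_fin sqr_ge0.
move=> /(ae_eq_integral_abs _ mD mf2); apply: filterS => x /= + Dx => /(_ Dx).
by move=> [] /eqP; rewrite sqrf_eq0 => /eqP.
Qed.

Lemma ge0_integral_RintegralE f : (forall x, D x -> 0 <= f x) ->
  mu.-integrable D (EFin \o f) ->
  (\int[mu]_(x in D) (f x)%:E)%E = (\int[mu]_(x in D) f x)%:E.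
Proof. by move=> f0 fi; rewrite /Rintegral fineK//; exact: integrable_fin_num. Qed.

(** Riesz--Fischer, for a sequence that is Cauchy with a geometric rate.  With
    d_n = f_(n+1) - f_n the series of the 2^n d_n^2 has a finite integral, hence
    is finite almost everywhere; as |d_n| <= 2^n d_n^2 + 2^-n, the sequence
    converges almost everywhere, and Fatou's lemma controls the distance to the
    limit. *)
Lemma L2_complete (f : nat -> T -> R) (K : R) :
  (forall n, L2 mu D (f n)) ->
  (forall n k, (n <= k)%N -> \int[mu]_(x in D) ((f n x - f k x) ^+ 2) <= K / 4 ^+ n) ->
  exists2 g, L2 mu D g &
    forall n, \int[mu]_(x in D) ((f n x - g x) ^+ 2) <= K / 4 ^+ n.
Proof.
move=> f2 fC.
have mf n : measurable_fun D (f n) by case: (f2 n).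
have B2 n k : mu.-integrable D (EFin \o (fun x => (f n x - f k x) ^+ 2)).
  by apply: L2_integrable_sqr; exact: L2B.
pose h n x : R := 2 ^+ n * (f n x - f n.+1 x) ^+ 2.
have h0 n x : 0 <= h n x by rewrite mulr_ge0 ?sqr_ge0// exprn_ge0.
have mh n : measurable_fun D (fun x => (h n x)%:E).
  apply/measurable_EFinP; apply: measurable_funM => //.
  by apply: measurable_funX; exact: measurable_funB.
have ih n : (\int[mu]_(x in D) (h n x)%:E <= (K * 2 / 2 ^+ n.+1)%:E)%E.
  rewrite ge0_integral_RintegralE//; last exact: (integrableZl mD _ (B2 n n.+1)).
  rewrite lee_fin RintegralZl//.
  apply: (le_trans (ler_wpM2l _ (fC n n.+1 (leqnSn n)))); first exact: exprn_ge0.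
  rewrite le_eqVlt; apply/orP; left; apply/eqP.
  have -> : (4 : R) = 2 * 2 by rewrite -natrM.
  have n0 : (2 ^+ n : R) != 0 by rewrite expf_neq0.
  by rewrite exprMn exprS; field; rewrite n0.
pose S x := (\sum_(n <oo) (h n x)%:E)%E.
have S_lty : (\int[mu]_(x in D) S x < +oo)%E.
  rewrite integral_nneseries//; last by move=> n x _; rewrite lee_fin.
  apply: (@le_lt_trans _ _ (\sum_(n <oo) ((K * 2) / (2 ^ (n + 1))%:R)%:E)%E).
    apply: lee_nneseries => [n _ _|n _]; first by apply: integral_ge0 => x _; rewrite lee_fin.
    by rewrite natrX addn1; exact: ih.
  have /cvg_lim -> // := @cvg_geometric_eseries_half R (K * 2) 0.
  exact: ltry.
have S_ge0 x : (0 <= S x)%E by apply: nneseries_ge0 => n _ _; rewrite lee_fin.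
have S_fin : {ae mu, forall x, D x -> S x \is a fin_num}.
  apply: (integrable_ae mD); apply/integrableP; split.
    by apply: ge0_emeasurable_sum => [n x _ _|n _] //; rewrite lee_fin.
  rewrite (eq_integral S); last by move=> x _; rewrite gee0_abs.
  exact: S_lty.
have f_cvg x : S x \is a fin_num -> cvgn (f ^~ x).
  move=> Sx.
  suff : cvgn (series (telescope (f ^~ x))).
    move=> cv; have -> : f ^~ x = (fun n => f 0%N x + series (telescope (f ^~ x)) n).
      by apply/funext => n; exact: (eq_sum_telescope (f ^~ x)).
    by apply: is_cvgD => //; exact: is_cvg_cst.
  apply: normed_cvg; apply: (@series_le_cvg _ _ (fun n => h n x + geometric 1 2^-1 n)).
  - by move=> n; exact: normr_ge0.
  - by move=> n; rewrite addr_ge0// /geometric /= mul1r exprn_ge0// invr_ge0.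
  - move=> n /=; rewrite /geometric /= mul1r exprVn /h /telescope.
    (* p^-1 (p |y| - 1)^2 >= 0 *)
    rewrite -normrN opprB; set y := f n x - _; set p := 2 ^+ n.
    have p0 : 0 < p by rewrite exprn_gt0.
    have pV : p * p^-1 = 1 by rewrite divff// gt_eqF.
    have V0 : 0 < p^-1 by rewrite invr_gt0.
    have -> : p * y ^+ 2 = p * `|y| ^+ 2 by rewrite real_normK// num_real.
    have := normr_ge0 y; move: `|y| => z z0.
    have : 0 <= p^-1 * (p * z - 1) ^+ 2 by rewrite mulr_ge0 ?sqr_ge0// ltW.
    have -> : p^-1 * (p * z - 1) ^+ 2 = p * z ^+ 2 - 2 * z + p^-1.
      by field; rewrite gt_eqF.
    lra.
  have -> : series (fun n => h n x + geometric 1 2^-1 n) =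
      (fun n => series (h ^~ x) n + series (geometric 1 2^-1) n).
    by apply/funext => n; rewrite /series /= big_split.
  apply: is_cvgD; last first.
    by apply: is_cvg_geometric_series; rewrite ger0_norm ?invr_ge0// invf_lt1// ltr1n.
  apply: nondecreasing_is_cvgn.
    move=> m n mn; rewrite /series /= (big_cat_nat (leq0n m) mn) //=.
    by rewrite lerDl sumr_ge0.
  exists (fine (S x)) => _ [n _ <-].
  rewrite -lee_fin fineK// /series /= -sumEFin.
  by apply: nneseries_lim_ge => k _; rewrite lee_fin.
(* the upper limit is a measurable limit that makes sense at every point *)
pose g x := fine (limn_esup (fun n => (f n x)%:E)).
have mg : measurable_fun D g.
  apply: (measurableT_comp (fine_measurable measurableT)).
  by apply: measurable_fun_limn_esup => n; apply/measurable_EFinP.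
have gE x : S x \is a fin_num -> f ^~ x @ \oo --> g x.
  move=> /f_cvg /cvg_ex[l fl]; rewrite /g.
  have : (fun n => (f n x)%:E) @ \oo --> l%:E by apply: cvg_EFin => //; exact: nearW.
  by move=> /cvg_limn_einf_sup[_ ->].
have gC n : (\int[mu]_(x in D) ((f n x - g x) ^+ 2)%:E <= (K / 4 ^+ n)%:E)%E.
  have mB k : measurable_fun D (fun x => ((f n x - f k x) ^+ 2)%:E).
    by apply/measurable_EFinP; apply: measurable_funX; exact: measurable_funB.
  have B0 k x : D x -> (0 <= ((f n x - f k x) ^+ 2)%:E)%E by rewrite lee_fin sqr_ge0.
  apply: (@le_trans _ _ (limn_einf
      (fun k => \int[mu]_(x in D) ((f n x - f k x) ^+ 2)%:E)%E)); last first.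
    rewrite limn_einf_lim; apply: lime_le; first exact: is_cvg_einfs.
    (* the Cauchy estimate needs an index of the tail that is at least n *)
    apply: nearW => m; apply: (@le_trans _ _
        (\int[mu]_(x in D) ((f n x - f (maxn m n) x) ^+ 2)%:E)%E).
      by apply: ereal_inf_lbound; exists (maxn m n) => //=; exact: leq_maxl.
    rewrite ge0_integral_RintegralE; [|by move=> *; exact: sqr_ge0|exact: B2].
    by rewrite lee_fin fC// leq_maxr.
  apply: (le_trans _ (fatou mu mD mB B0)).
  apply: ae_ge0_le_integral => //.
  - by move=> x _; rewrite lee_fin sqr_ge0.
  - by apply/measurable_EFinP; apply: measurable_funX; exact: measurable_funB.
  - move=> x Dx; rewrite limn_einf_lim; apply: lime_ge; first exact: is_cvg_einfs.
    by apply: nearW => m; apply: le_ereal_inf_tmp => _ [k _ <-]; exact: B0.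
  - rewrite /limn_einf; apply: measurableT_comp; first exact: oppe_measurable.
    by apply: measurable_fun_limn_esup => k; exact: measurableT_comp (mB k).
  apply: filterS S_fin => x + Dx => /(_ Dx)/gE fg.
  suff : (fun k => ((f n x - f k x) ^+ 2)%:E) @ \oo --> ((f n x - g x) ^+ 2)%:E.
    by move=> /cvg_limn_einf_sup[-> _].
  apply: cvg_EFin; first exact: nearW.
  have : (fun k => f n x - f k x) @ \oo --> f n x - g x.
    by apply: cvgB => //; exact: cvg_cst.
  by move=> c; under eq_fun do rewrite /= expr2; rewrite expr2; exact: cvgM.
have B2g n : L2 mu D (fun x => f n x - g x).
  split; first exact: measurable_funB.
  apply/integrableP; split.
    by apply/measurable_EFinP; apply: measurable_funX; exact: measurable_funB.
  under eq_integral do rewrite gee0_abs ?lee_fin ?sqr_ge0//.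
  by apply: le_lt_trans (gC n) _; rewrite ltry.
exists g => [|n].
  have := L2B (f2 0%N) (B2g 0%N); congr L2; apply/funext => x.
  by rewrite opprB addrC subrK.
rewrite -lee_fin -ge0_integral_RintegralE//.
- by move=> *; exact: sqr_ge0.
- exact: L2_integrable_sqr.
Qed.

End L2Space.
(** * Riesz representation in a complete semi-inner product space *)

Lemma le0_of_geometric (R : archiRealFieldType) (x C : R) :
  (forall n, x <= C / 4 ^+ n) -> x <= 0.
Proof.
move=> xC; rewrite leNgt; apply/negP => x0.
have C0 : 0 < C by have := xC 0%N; rewrite expr0 divr1; exact: lt_le_trans.
have := archi_boundP (ltW (divr_gt0 C0 x0)); set n := Num.bound _ => Cn.
have := xC n; rewrite ler_pdivlMr ?exprn_gt0// leNgt => /negP; apply.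
rewrite mulrC -ltr_pdivrMr//; apply: (lt_trans Cn).
by rewrite -natrX ltr_nat; exact: ltn_expl.
Qed.

(** A minimizing sequence of J(u) = a(u, u) - 2 l(u) over the subspace S is Cauchy
    by the parallelogram identity.  The first variation of J at its n-th term is
    bounded by the square root of the excess over the infimum, so it vanishes at
    the limit, which is the Euler equation a(u, .) = l.  The form is only
    semidefinite because vectors are meant to be representatives of functions,
    and completeness is asked at the rate 4^-n only, which a minimizing sequence
    can always be chosen to achieve. *)
Lemma riesz_representation (R : realType) (V : lmodType R) (S : set V)
    (a : V -> V -> R) (l : V -> R) (K : R) :
  S 0 -> (forall (c : R) u v, S u -> S v -> S (c *: u + v)) ->
  (forall u v, a u v = a v u) ->
  (forall (c : R) u v w, a (c *: u + v) w = c * a u w + a v w) ->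
  (forall u, 0 <= a u u) ->
  (forall (c : R) u v, l (c *: u + v) = c * l u + l v) ->
  0 <= K -> (forall u, l u ^+ 2 <= K * a u u) ->
  (forall (v : nat -> V) (C : R), (forall n, S (v n)) ->
     (forall n k, (n <= k)%N -> a (v n - v k) (v n - v k) <= C / 4 ^+ n) ->
     exists u, S u /\
       exists C', forall n, a (v n - u) (v n - u) <= C' / 4 ^+ n) ->
  exists2 u, S u & forall w, S w -> a u w = l w.
Proof.
move=> S0 Slin aC aL a0 lL K0 lK complete.
have aR (c : R) u v w : a w (c *: u + v) = c * a w u + a w v.
  by rewrite aC aL !(aC w).
have a_expand (t : R) u w :
    a (t *: w + u) (t *: w + u) = a u u + 2 * t * a u w + t ^+ 2 * a w w.
  by rewrite !aL !aR (aC w u); ring.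
have CS u w : a u w ^+ 2 <= a u u * a w w.
  by apply: sqr_le_of_quadratic_ge0 => t; rewrite -a_expand.
pose J u := a u u - 2 * l u.
have J_ge u : - K <= J u.
  rewrite leNgt; apply/negP => JK.
  have := lK u; have := a0 u; rewrite /J in JK.
  set p := a u u in JK *; set q := l u in JK * => p0.
  suff : K * p < q ^+ 2 by rewrite ltNge => /negP.
  have : (p + K) ^+ 2 < (2 * q) ^+ 2.
    by rewrite ltr_pXn2r ?nnegrE//; lra.
  have := sqr_ge0 (p - K); rewrite !expr2; lra.
pose E := [set J u | u in S].
have E_inf : has_inf E.
  by split; [exists (J 0), 0|exists (- K) => _ [u _ <-]; exact: J_ge].
pose m := inf E.
have m_le u : S u -> m <= J u by move=> Su; apply: ge_inf; [case: E_inf|exists u].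
have /choice[v v_min] : forall n, exists u, S u /\ J u < m + 1 / 4 ^+ n.
  move=> n; have e0 : 0 < (1 : R) / 4 ^+ n by rewrite divr_gt0 ?exprn_gt0.
  by have [_ [u Su <-] Jm] := inf_adherent e0 E_inf; exists u.
have vS n : S (v n) by case: (v_min n).
have SZ (c : R) u : S u -> S (c *: u).
  by move=> Su; rewrite -[_ *: _]addr0; exact: Slin.
have lZ (c : R) u : l (c *: u) = c * l u.
  have l00 : l 0 = 0 by have := lL (-1) 0 0; rewrite scaler0 addr0 mulN1r addNr.
  by rewrite -[c *: u]addr0 lL l00 addr0.
have aZ (c : R) u : a (c *: u) (c *: u) = c ^+ 2 * a u u.
  have := a_expand c (0 : V) u; rewrite addr0 => ->.
  have a0w w : a 0 w = 0.
    by have := aL (-1) 0 0 w; rewrite scaler0 addr0 mulN1r addNr.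
  by rewrite !a0w; ring.
have parallelogram u w : S u -> S w ->
    a (u - w) (u - w) <= 2 * (J u - m) + 2 * (J w - m).
  move=> Su Sw; have := m_le (2^-1 *: (1 *: u + w)) (SZ _ _ (Slin _ _ _ Su Sw)).
  have -> : u - w = (-1) *: w + u by rewrite scaleN1r addrC.
  rewrite /J aZ lZ lL !a_expand (aC w u) !expr2; lra.
(* both excesses are below 4^-n and enter the parallelogram bound twice *)
have [||u [Su [C uC]]] := complete v 4 => //.
  move=> n k nk; apply: (le_trans (parallelogram _ _ (vS n) (vS k))).
  have [_ Jn] := v_min n; have [_ Jk] := v_min k.
  have : (1 : R) / 4 ^+ k <= 1 / 4 ^+ n.
    by rewrite !div1r lef_pV2 ?posrE ?exprn_gt0// ler_weXn2l// ler1n.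
  have -> : (4 : R) / 4 ^+ n = 4 * (1 / 4 ^+ n) by rewrite div1r.
  lra.
exists u => // w Sw; apply/eqP; rewrite -subr_eq0 -sqrf_eq0 eq_le sqr_ge0 andbT.
apply: (@le0_of_geometric _ _ (2 * (1 + C) * a w w)) => n.
have variation : (a (v n) w - l w) ^+ 2 <= (J (v n) - m) * a w w.
  apply: sqr_le_of_quadratic_ge0 => t.
  have := m_le _ (Slin t _ _ Sw (vS n)); rewrite /J a_expand lL; lra.
have [_ Jn] := v_min n.
have dist := CS (v n - u) w.
have -> : a u w = a (v n) w - a (v n - u) w.
  have -> : v n - u = (-1) *: u + v n by rewrite scaleN1r addrC.
  by rewrite aL; ring.
set x := a (v n) w in variation *; set y := a (v n - u) w in dist *.
have variation' : (x - l w) ^+ 2 <= (1 / 4 ^+ n) * a w w.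
  by apply: (le_trans variation); rewrite ler_wpM2r//; lra.
have dist' : y ^+ 2 <= C / 4 ^+ n * a w w.
  by apply: (le_trans dist); rewrite ler_wpM2r.
have -> : 2 * (1 + C) * a w w / 4 ^+ n =
    2 * (1 / 4 ^+ n * a w w) + 2 * (C / 4 ^+ n * a w w) by ring.
have := sqr_ge0 (x - l w + y); rewrite !expr2 in variation' dist' *; lra.
Qed.
(** * Pairing with test functions *)

Lemma L2_bounded_fun d' (T : measurableType d') (R : realType)
    (mu : {measure set T -> \bar R}) (D : set T) (f : T -> R) (M : R) :
  measurable D -> (mu D < +oo)%E -> measurable_fun D f ->
  (forall x, D x -> `|f x| <= M) -> L2 mu D f.
Proof.
move=> mD muD mf fM; split => //.
have iM : mu.-integrable D (EFin \o cst (M ^+ 2)).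
  apply/integrableP; split; first exact/measurable_EFinP/measurable_cst.
  rewrite /comp /= (integral_cst _ mD (`|(M ^+ 2)%:E|%E)).
  by apply: lte_mul_pinfty; [exact: abse_ge0|rewrite abse_fin_num|].
apply: (le_integrable mD _ _ iM).
  by apply/measurable_EFinP; exact: measurable_funX.
move=> x Dx /=; rewrite lee_fin !normrX ler_pXn2r ?nnegrE//.
by apply: le_trans (fM x Dx) _; exact: ler_norm.
Qed.

Section TestFunctions.
Context (R : realType) (d : nat) (Omega : set 'rV[R]_d).
Hypotheses (oO : open Omega) (bO : bounded_set Omega).
Local Notation leb := (lebesgueRn R d).

Lemma L2_compact_support (f : 'rV[R]_d -> R) (K : set 'rV[R]_d) :
  continuous f -> compact K -> (forall x, ~ K x -> f x = 0) -> L2 leb Omega f.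
Proof.
move=> cf cK fK; have mO := lebesgue_measurable_open oO.
have [M [_ fM]] : bounded_set (f @` K).
  apply: compact_bounded; apply: continuous_compact => //.
  exact: continuous_subspaceT.
have M1 : M < `|M| + 1 by apply: le_lt_trans (ler_norm M) _; rewrite ltrDl.
apply: (@L2_bounded_fun _ _ _ _ _ _ (`|M| + 1)) => //.
- exact: lebesgue_bounded_lty.
- exact: continuous_lebesgue_measurable.
- move=> x _; have [Kx|/fK ->] := pselect (K x); last by rewrite normr0 addr_ge0.
  by apply: (fM _ M1); exists x.
Qed.

Variables (phi : 'rV[R]_d -> R) (phi_test : test_function Omega phi).

Lemma L2_test_function : L2 leb Omega phi.
Proof.
have [sphi [K [cK _ phiK]]] := phi_test; have [cphi _] := sphi 0%N.
exact: L2_compact_support cphi cK phiK.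
Qed.

(** A derivative is local, so the partial derivatives vanish off the same compact
    set, whose complement is open. *)
Lemma L2_partial_test_function (i : 'I_d) : L2 leb Omega (partial i phi).
Proof.
have [sphi [K [cK _ phiK]]] := phi_test.
have [_ /(_ i)[_ [cphi _]]] := sphi 1%N.
apply: (L2_compact_support cphi cK) => x Kx.
rewrite /partial (near_eq_derive (g := cst 0)); first exact: derive_cst.
have /closed_openC oK : closed K by apply: compact_closed => //; exact: norm_hausdorff.
have : nbhs x (~` K) by exact: open_nbhs_nbhs.
by apply: filterS => y; exact: phiK.
Qed.

End TestFunctions.

(** * The space H^1 *)

Section WeakPartial.
Context (R : realType) (d : nat) (Omega : set 'rV[R]_d).
Hypotheses (oO : open Omega) (bO : bounded_set Omega).
Local Notation leb := (lebesgueRn R d).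
Let mO := lebesgue_measurable_open oO.

Lemma weak_partial_ZD (i : 'I_d) (c : R) (f f' g g' : 'rV[R]_d -> R) :
  L2 leb Omega f -> L2 leb Omega f' -> L2 leb Omega g -> L2 leb Omega g' ->
  weak_partial Omega i f f' -> weak_partial Omega i g g' ->
  weak_partial Omega i (fun x => c * f x + g x) (fun x => c * f' x + g' x).
Proof.
move=> f2 f'2 g2 g'2 ff' gg' phi phi_test.
have p2 := L2_test_function oO bO phi_test.
have dp2 := L2_partial_test_function oO bO phi_test i.
rewrite !(L2_pairing_ZD mO)// ff'// gg'//; ring.
Qed.

(** Weak derivatives pass to L^2 limits, because both sides of the defining
    identity are L^2 pairings with a fixed function. *)
Lemma weak_partial_closed (i : 'I_d) (f f' : 'rV[R]_d -> R)
    (fn fn' : nat -> 'rV[R]_d -> R) (C : R) :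
  L2 leb Omega f -> L2 leb Omega f' ->
  (forall n, L2 leb Omega (fn n)) -> (forall n, L2 leb Omega (fn' n)) ->
  (forall n, weak_partial Omega i (fn n) (fn' n)) ->
  (forall n, \int[leb]_(x in Omega) ((fn n x - f x) ^+ 2) <= C / 4 ^+ n) ->
  (forall n, \int[leb]_(x in Omega) ((fn' n x - f' x) ^+ 2) <= C / 4 ^+ n) ->
  weak_partial Omega i f f'.
Proof.
move=> f2 f'2 fn2 fn'2 W fC f'C phi phi_test.
have p2 := L2_test_function oO bO phi_test.
have dp2 := L2_partial_test_function oO bO phi_test i.
set a := LHS; set b := \int[leb]_(x in Omega) (f' x * phi x).
apply/eqP; rewrite -subr_eq0 opprK -sqrf_eq0 eq_le sqr_ge0 andbT.
pose A := \int[leb]_(x in Omega) (partial i phi x ^+ 2).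
pose B := \int[leb]_(x in Omega) (phi x ^+ 2).
have A0 : 0 <= A by apply: Rintegral_ge0 => x _; exact: sqr_ge0.
have B0 : 0 <= B by apply: Rintegral_ge0 => x _; exact: sqr_ge0.
apply: (@le0_of_geometric _ _ (2 * C * (A + B))) => n.
have CS1 := L2_cauchy_schwarz mO (L2B mO (fn2 n) f2) dp2.
have CS2 := L2_cauchy_schwarz mO (L2B mO (fn'2 n) f'2) p2.
have := le_trans CS1 (ler_wpM2r A0 (fC n)).
have := le_trans CS2 (ler_wpM2r B0 (f'C n)).
rewrite !(L2_pairing_B mO)// W// -/a -/b -/A -/B.
set y := \int[leb]_(x in Omega) (fn' n x * phi x) => h1 h2.
have -> : 2 * C * (A + B) / 4 ^+ n = 2 * (C / 4 ^+ n * A) + 2 * (C / 4 ^+ n * B) by ring.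
have := sqr_ge0 ((- y - a) - (y - b)); rewrite !expr2 in h1 h2 *; lra.
Qed.

End WeakPartial.

Section H1Space.
Context (R : realType) (d : nat) (Omega : set 'rV[R]_d).
Local Notation leb := (lebesgueRn R d).

(** Equality here is pointwise equality of the representatives and of their
    gradients; the proofs they carry are irrelevant.  This gives the records an
    honest vector space structure without a quotient. *)
Lemma H1_ext (u v : H1 Omega) :
  H1_val u =1 H1_val v -> (forall i, H1_grad u i =1 H1_grad v i) -> u = v.
Proof.
case: u => u Du u2 Du2 uDu; case: v => v Dv v2 Dv2 vDv /= /funext uv Duv.
have DuvE : Du = Dv by apply/funext => i; apply/funext; exact: Duv.
by subst v Dv; congr MkH1; exact: Prop_irrelevance.
Qed.

(** The vector space of representatives with their weak gradients.  Openness and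
    boundedness of the domain are carried by the type, because the additivity of
    weak derivatives rests on the integrability of the pairings with test
    functions. *)
Definition H1_space (oO : open Omega) (bO : bounded_set Omega) : Type := H1 Omega.

Variables (oO : open Omega) (bO : bounded_set Omega).
Let mO := lebesgue_measurable_open oO.

Lemma weak_partial0 (i : 'I_d) : weak_partial Omega i (cst 0) (cst 0).
Proof.
move=> phi _; rewrite !(@eq_Rintegral _ _ _ leb Omega (cst 0)).
- by rewrite !(Rintegral_cst _ mO) mul0r oppr0.
- by move=> x _ /=; rewrite mul0r.
- by move=> x _ /=; rewrite mul0r.
Qed.

Lemma weak_partialD (u v : H1 Omega) (i : 'I_d) :
  weak_partial Omega i (fun x => u x + v x) (fun x => H1_grad u i x + H1_grad v i x).
Proof.
have := weak_partial_ZD oO bO 1 (H1_val_L2 u) (H1_grad_L2 u i)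
  (H1_val_L2 v) (H1_grad_L2 v i) (@H1_weak_partial _ _ _ u i) (@H1_weak_partial _ _ _ v i).
by congr weak_partial; apply/funext => x; rewrite mul1r.
Qed.

Lemma weak_partialZ (c : R) (u : H1 Omega) (i : 'I_d) :
  weak_partial Omega i (fun x => c * u x) (fun x => c * H1_grad u i x).
Proof.
have := weak_partial_ZD oO bO c (H1_val_L2 u) (H1_grad_L2 u i)
  (L2_cst0 leb Omega) (L2_cst0 leb Omega) (@H1_weak_partial _ _ _ u i) (weak_partial0 i).
by congr weak_partial; apply/funext => x; rewrite addr0.
Qed.

Definition H1_zero : H1_space oO bO :=
  MkH1 (L2_cst0 leb Omega) (fun=> L2_cst0 leb Omega) weak_partial0.

Definition H1_add (u v : H1_space oO bO) : H1_space oO bO :=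
  MkH1 (L2D mO (H1_val_L2 u) (H1_val_L2 v))
    (fun i => L2D mO (H1_grad_L2 u i) (H1_grad_L2 v i)) (weak_partialD u v).

Definition H1_scale (c : R) (u : H1_space oO bO) : H1_space oO bO :=
  MkH1 (L2Z mO c (H1_val_L2 u)) (fun i => L2Z mO c (H1_grad_L2 u i)) (weak_partialZ c u).

Lemma H1_addA : associative H1_add.
Proof. by move=> u v w; apply: H1_ext => [x|i x]; exact: addrA. Qed.

Lemma H1_addC : commutative H1_add.
Proof. by move=> u v; apply: H1_ext => [x|i x]; exact: addrC. Qed.

Lemma H1_add0 : left_id H1_zero H1_add.
Proof. by move=> u; apply: H1_ext => [x|i x]; exact: add0r. Qed.

Lemma H1_addN : left_inverse H1_zero (H1_scale (-1)) H1_add.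
Proof. by move=> u; apply: H1_ext => [x|i x]; rewrite /= mulN1r addNr. Qed.

HB.instance Definition _ := gen_eqMixin (H1_space oO bO).
HB.instance Definition _ := gen_choiceMixin (H1_space oO bO).
HB.instance Definition _ := GRing.isZmodule.Build (H1_space oO bO)
  H1_addA H1_addC H1_add0 H1_addN.

Lemma H1_scaleA (b c : R) (u : H1_space oO bO) :
  H1_scale b (H1_scale c u) = H1_scale (b * c) u.
Proof. by apply: H1_ext => [x|i x]; exact: mulrA. Qed.

Lemma H1_scale1 : left_id 1 H1_scale.
Proof. by move=> u; apply: H1_ext => [x|i x]; exact: mul1r. Qed.

Lemma H1_scaleDr : right_distributive H1_scale +%R.
Proof. by move=> c u v; apply: H1_ext => [x|i x]; exact: mulrDr. Qed.

Lemma H1_scaleDl (u : H1_space oO bO) : {morph H1_scale^~ u : b c / b + c}.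
Proof. by move=> b c; apply: H1_ext => [x|i x]; exact: mulrDl. Qed.

HB.instance Definition _ := GRing.Zmodule_isLmodule.Build R (H1_space oO bO)
  H1_scaleA H1_scale1 H1_scaleDr H1_scaleDl.

Lemma H1_sqnorm_ge0 (u : H1 Omega) : 0 <= H1_sqnorm u.
Proof. by rewrite addr_ge0 ?sumr_ge0// => *; apply: Rintegral_ge0 => *; exact: sqr_ge0. Qed.

Lemma H1_sqnormB (u v : H1_space oO bO) : H1_sqnorm (u - v) = H1_sqdist u v.
Proof.
congr (_ + _); first by apply: eq_Rintegral => x _; rewrite /= mulN1r.
by apply: eq_bigr => i _; apply: eq_Rintegral => x _; rewrite /= mulN1r.
Qed.

Lemma H1_val_sqdist_le (u v : H1 Omega) :
  \int[leb]_(x in Omega) ((u x - v x) ^+ 2) <= H1_sqdist u v.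
Proof.
by rewrite lerDl; apply: sumr_ge0 => i _; apply: Rintegral_ge0 => x _; exact: sqr_ge0.
Qed.

Lemma H1_grad_sqdist_le (u v : H1 Omega) (i : 'I_d) :
  \int[leb]_(x in Omega) ((H1_grad u i x - H1_grad v i x) ^+ 2) <= H1_sqdist u v.
Proof.
rewrite /H1_sqdist (bigD1 i)//= addrCA lerDl addr_ge0//.
  by apply: Rintegral_ge0 => x _; exact: sqr_ge0.
by apply: sumr_ge0 => j _; apply: Rintegral_ge0 => x _; exact: sqr_ge0.
Qed.

(** L^2-limits of the functions and of their weak gradients exist separately, and
    closedness of the weak derivative matches them. *)
Lemma H1_complete (v : nat -> H1_space oO bO) (C : R) :
  (forall n k, (n <= k)%N -> H1_sqnorm (v n - v k) <= C / 4 ^+ n) ->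
  exists u : H1_space oO bO,
    forall n, H1_sqnorm (v n - u) <= (d.+1%:R * C) / 4 ^+ n.
Proof.
move=> vC.
have [|f f2 fC] := L2_complete mO (fun n => H1_val_L2 (v n)) (K := C).
  move=> n k nk; apply: le_trans (vC n k nk); rewrite H1_sqnormB.
  exact: H1_val_sqdist_le.
have /choice[f' f'P] : forall i, exists g, L2 leb Omega g /\
    forall n, \int[leb]_(x in Omega) ((H1_grad (v n) i x - g x) ^+ 2) <= C / 4 ^+ n.
  move=> i.
  have [|g g2 gC] := L2_complete mO (fun n => H1_grad_L2 (v n) i) (K := C).
    move=> n k nk; apply: le_trans (vC n k nk); rewrite H1_sqnormB.
    exact: H1_grad_sqdist_le.
  by exists g.
have wf i : weak_partial Omega i f (f' i).
  have [f'2 f'C] := f'P i.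
  apply: (weak_partial_closed oO bO f2 f'2 _ _ _ fC f'C) => n.
  - exact: H1_val_L2.
  - exact: H1_grad_L2.
  - exact: H1_weak_partial.
exists (MkH1 f2 (fun i => (f'P i).1) wf) => n.
rewrite H1_sqnormB /H1_sqdist.
rewrite (_ : d.+1%:R * C / 4 ^+ n = C / 4 ^+ n + \sum_(i < d) C / 4 ^+ n).
  by apply: lerD; [exact: fC|apply: ler_sum => i _; exact: (f'P i).2 n].
by rewrite sumr_const card_ord -mulr_natl -[d.+1]add1n natrD; ring.
Qed.

End H1Space.
(** * Fields with a vanishing trace *)

Section Trace.
Context (R : realType) (d : nat) (Omega : set 'rV[R]_d).
Context (gamma : ('rV[R]_d -> R) -> 'rV[R]_d -> R).
Context (oO : open Omega) (bO : bounded_set Omega).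
Hypothesis (trace_gamma : trace_operator Omega gamma).
Local Notation H1s := (H1_space oO bO).
Local Notation surf := (@surface R d).
Implicit Types (G : set 'rV[R]_d) (f g : 'I_d -> 'rV[R]_d -> R).

Let ae_surface_filter : Filter (almost_everywhere surf) := ae_filter_ringOfSetsType surf.

Lemma V_ZD G f g (u v : 'I_d -> H1s) (c : R) : G `<=` boundary Omega ->
  V gamma G f u -> V gamma G g v ->
  V gamma G (fun i x => c * f i x + g i x) (c *: u + v).
Proof.
move=> GO uf vg i; have F := ae_surface_filter.
apply: filterS3 (uf i) (vg i) (trace_linear trace_gamma c (u i) (v i)).
move=> x ux vx uvx Gx; rewrite -(ux Gx) -(vx Gx).
exact: uvx (GO _ Gx).
Qed.

Lemma V0_zero G : G `<=` boundary Omega ->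
  V gamma G (fun _ _ => 0) (0 : 'I_d -> H1s).
Proof.
move=> GO i; have F := ae_surface_filter.
(* gamma 0 = - gamma 0 + gamma 0 by linearity *)
have := trace_linear trace_gamma (-1) (0 : H1s) (0 : H1s).
apply: filterS => x /[swap] /GO Ox /(_ Ox).
rewrite mulN1r addNr => <-; congr gamma.
by apply/funext => y /=; rewrite mulr0 addr0.
Qed.

(** On G the traces of v_n - u and of u have the same square, and the trace of
    v_n - u tends to 0 in L^2 of the boundary because the trace is bounded. *)
Lemma trace0_closed G (v : nat -> H1s) (u : H1s) (C : R) :
  measurable (G : set (caratheodory_type (hausdorff_outer d.-1))) ->
  measurable (boundary Omega : set (caratheodory_type (hausdorff_outer d.-1))) ->
  G `<=` boundary Omega ->
  (forall n, {ae surf, forall x, G x -> gamma (v n) x = 0}) ->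
  (forall n, H1_sqnorm (v n - u) <= C / 4 ^+ n) ->
  {ae surf, forall x, G x -> gamma u x = 0}.
Proof.
move=> mG mO GO v0 vC; have F := ae_surface_filter.
have L2S h := @L2_subset _ _ _ surf _ mO G h mG GO.
have [C0 gammaC] := trace_bounded trace_gamma.
have u2 := trace_L2 trace_gamma u.
apply: (L2_ae0 mG (L2S _ u2)); apply/eqP; rewrite eq_le.
rewrite [X in _ && X]Rintegral_ge0 ?andbT; last by move=> x _; exact: sqr_ge0.
apply: (@le0_of_geometric _ _ (`|C0| * C)) => n.
have d2 := trace_L2 trace_gamma (v n - u).
apply: (@le_trans _ _ (C0 * H1_sqnorm (v n - u))); last first.
  have H0 := H1_sqnorm_ge0 (v n - u).
  apply: (@le_trans _ _ (`|C0| * H1_sqnorm (v n - u))).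
    by rewrite ler_wpM2r// ler_norm.
  by rewrite -mulrA ler_wpM2l.
apply: le_trans (gammaC (v n - u)).
apply: (@le_trans _ _ (\int[surf]_(x in G) (gamma (v n - u) x ^+ 2))).
  rewrite le_eqVlt; apply/orP; left; apply/eqP.
  apply: (L2_ae_eq mG (L2S _ u2) (L2S _ d2)).
  have := trace_linear trace_gamma (-1) u (v n).
  apply: filterS2 (v0 n) => x vx uvx Gx /=.
  have := uvx (GO _ Gx); rewrite (vx Gx) addr0 mulN1r => E.
  suff -> : gamma (v n - u) x = - gamma u x by rewrite sqrrN.
  by rewrite -E; congr gamma; apply/funext => y /=; rewrite addrC.
exact: (L2_le_subset mO mG GO d2).
Qed.

End Trace.
(** * The elasticity tensor *)

Section ElasticityTensor.
Context (R : realType) (d : nat).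
Implicit Types A B C : 'M[R]_d.

Definition hooke (lambda mu : R) A : 'M[R]_d :=
  (lambda * \tr A) *: 1%:M + (2 * mu) *: A.

Lemma ddotC A B : ddot A B = ddot B A.
Proof. by apply: eq_bigr => i _; apply: eq_bigr => j _; rewrite mulrC. Qed.

Lemma ddot_ZDl (c : R) A B C : ddot (c *: A + B) C = c * ddot A C + ddot B C.
Proof.
rewrite /ddot mulr_sumr -big_split; apply: eq_bigr => i _ /=.
rewrite mulr_sumr -big_split; apply: eq_bigr => j _ /=.
by rewrite !mxE; ring.
Qed.

Lemma ddot1 A : ddot 1%:M A = \tr A.
Proof.
apply: eq_bigr => i _; rewrite (bigD1 i)//= big1 => [|j ji].
  by rewrite mxE eqxx mul1r addr0.
by rewrite mxE eq_sym (negPf ji) mul0r.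
Qed.

Lemma ddot_ge0 A : 0 <= ddot A A.
Proof. by do 2 (apply: sumr_ge0 => ? _); rewrite -expr2 sqr_ge0. Qed.

Lemma ddot_hooke (lambda mu : R) A B :
  ddot (hooke lambda mu A) B = lambda * \tr A * \tr B + 2 * mu * ddot A B.
Proof.
rewrite /hooke ddot_ZDl ddot1; congr (_ + _).
have := ddot_ZDl (2 * mu) A 0 B; rewrite addr0 => ->.
rewrite [ddot 0 B]big1 ?addr0// => i _; rewrite big1// => j _.
by rewrite mxE mul0r.
Qed.

(** Cauchy--Schwarz for the vectors of ones and of diagonal entries. *)
Lemma sqr_mxtrace_le A : \tr A ^+ 2 <= d%:R * ddot A A.
Proof.
apply: (@le_trans _ _ (d%:R * \sum_i A i i ^+ 2)).
  apply: sqr_le_of_quadratic_ge0 => t.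
  have -> : d%:R + 2 * t * \tr A + t ^+ 2 * \sum_i A i i ^+ 2 =
      \sum_(i < d) (1 + t * A i i) ^+ 2.
    rewrite /mxtrace !mulr_sumr -[d in d%:R]card_ord -sumr_const -!big_split /=.
    by apply: eq_bigr => i _; ring.
  by apply: sumr_ge0 => i _; exact: sqr_ge0.
rewrite ler_wpM2l//; apply: ler_sum => i _; rewrite (bigD1 i)//= expr2 lerDl.
by apply: sumr_ge0 => j _; rewrite -expr2 sqr_ge0.
Qed.

(** Since (tr A)^2 <= d |A|^2, a negative lambda costs at most d |lambda| |A|^2;
    the hypothesis lambda > - 2 mu / d keeps this below 2 mu |A|^2. *)
Lemma hooke_elliptic (lambda mu : R) A : (0 < d)%N -> - (2 * mu / d%:R) < lambda ->
  Num.min (2 * mu) (2 * mu + d%:R * lambda) * ddot A A <= ddot (hooke lambda mu A) A.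
Proof.
move=> d0 lam; rewrite ddot_hooke -mulrA -expr2.
have := sqr_mxtrace_le A; have := ddot_ge0 A; have := sqr_ge0 (\tr A).
set s := ddot A A; set t := _ ^+ 2 => t0 s0 ts.
have [l0|l0] := leP 0 lambda.
  apply: (@le_trans _ _ (2 * mu * s)); last by rewrite lerDr mulr_ge0.
  by rewrite ler_wpM2r// ge_min lexx.
apply: (@le_trans _ _ ((2 * mu + d%:R * lambda) * s)).
  by rewrite ler_wpM2r// ge_min lexx orbT.
by nra.
Qed.

Lemma hooke_elliptic_const (lambda mu : R) : (0 < d)%N -> 0 < mu ->
  - (2 * mu / d%:R) < lambda -> 0 < Num.min (2 * mu) (2 * mu + d%:R * lambda).
Proof.
move=> d0 mu0; rewrite -mulNr ltr_pdivrMr ?ltr0n// => lam.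
by rewrite lt_min; apply/andP; split; lra.
Qed.

Lemma hooke_bounded (lambda mu : R) A : 0 < mu ->
  ddot (hooke lambda mu A) A <= (d%:R * `|lambda| + 2 * mu) * ddot A A.
Proof.
move=> mu0; rewrite ddot_hooke -(mulrA lambda) -expr2 [leRHS]mulrDl lerD2r.
rewrite (mulrC d%:R) -mulrA; apply: (@le_trans _ _ (`|lambda| * \tr A ^+ 2)).
  by rewrite ler_wpM2r ?sqr_ge0// ler_norm.
by rewrite ler_wpM2l// sqr_mxtrace_le.
Qed.

(** Symmetrization is an orthogonal projection, hence a contraction. *)
Lemma ddot_sym_part_le A :
  ddot (\matrix_(i, j) (2^-1 * (A i j + A j i))) (\matrix_(i, j) (2^-1 * (A i j + A j i)))
  <= ddot A A.
Proof.
have <- : 2^-1 * (ddot A A + ddot A^T A^T) = ddot A A.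
  have -> : ddot A^T A^T = ddot A A.
    by rewrite /ddot exchange_big; do 2 (apply: eq_bigr => ? _); rewrite !mxE.
  by lra.
rewrite /ddot -big_split mulr_sumr; apply: ler_sum => i _ /=.
rewrite -big_split mulr_sumr; apply: ler_sum => j _ /=.
rewrite !mxE; have := sqr_ge0 (A i j - A j i); rewrite expr2; lra.
Qed.

End ElasticityTensor.

(** * Bilinear form of linear elasticity *)

Section ElasticForm.
Context (R : realType) (d : nat) (Omega : set 'rV[R]_d).
Context (oO : open Omega) (bO : bounded_set Omega).
Variables (lambda mu aL Theta0 : R) (Theta : 'rV[R]_d -> R).
Hypothesis Theta_L2 : L2 (lebesgueRn R d) Omega Theta.
Local Notation leb := (lebesgueRn R d).
Local Notation field := ('I_d -> H1_space oO bO).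
Let mO := lebesgue_measurable_open oO.
Implicit Types (A B C : 'rV[R]_d -> 'M[R]_d) (u v w : field).

Definition L2_matrix A := forall i j, L2 leb Omega (fun x => A x i j).

Definition elastic_form A B : R :=
  \int[leb]_(x in Omega) ddot (hooke lambda mu (A x)) (B x).

Lemma integrable_ddot A B : L2_matrix A -> L2_matrix B ->
  leb.-integrable Omega (EFin \o (fun x => ddot (A x) (B x))).
Proof.
move=> A2 B2.
do 2 (apply: (integrable_big mO) => ?).
exact: (L2_integrableM mO).
Qed.

Lemma L2_hooke A : L2_matrix A -> L2_matrix (fun x => hooke lambda mu (A x)).
Proof.
move=> A2 i j.
have trA2 : L2 leb Omega (fun x => \tr (A x)) by exact: (L2_sum mO).
have := L2D mO (L2Z mO (lambda * (1%:M : 'M[R]_d) i j) trA2) (L2Z mO (2 * mu) (A2 i j)).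
by congr L2; apply/funext => x; rewrite !mxE; ring.
Qed.

Lemma integrable_elastic A B : L2_matrix A -> L2_matrix B ->
  leb.-integrable Omega (EFin \o (fun x => ddot (hooke lambda mu (A x)) (B x))).
Proof. by move=> A2 B2; exact: integrable_ddot (L2_hooke A2) B2. Qed.

Lemma elastic_formC A B : elastic_form A B = elastic_form B A.
Proof.
by apply: eq_Rintegral => x _; rewrite !ddot_hooke (ddotC (A x)); congr (_ + _); ring.
Qed.

Lemma elastic_form_ZDl (c : R) A B C : L2_matrix A -> L2_matrix B -> L2_matrix C ->
  elastic_form (fun x => c *: A x + B x) C = c * elastic_form A C + elastic_form B C.
Proof.
move=> A2 B2 C2; rewrite /elastic_form.
rewrite -(RintegralZDl mO c (integrable_elastic A2 C2) (integrable_elastic B2 C2)).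
apply: eq_Rintegral => x _; rewrite !ddot_hooke ddot_ZDl.
by rewrite linearP /=; ring.
Qed.

Lemma strain_ZD (c : R) u v : strain (c *: u + v) = fun x => c *: strain u x + strain v x.
Proof. by apply/funext => x; apply/matrixP => i j; rewrite !mxE /=; ring. Qed.

Lemma L2_strain u : L2_matrix (strain u).
Proof.
move=> i j.
have := L2Z mO 2^-1 (L2D mO (H1_grad_L2 (u i) j) (H1_grad_L2 (u j) i)).
by congr L2; apply/funext => x; rewrite mxE.
Qed.

Local Notation tstrain := (thermal_strain aL Theta0 Theta).

Lemma L2_thermal_strain u : L2_matrix (tstrain u).
Proof.
move=> i j.
have T2 : L2 leb Omega (cst Theta0).
  apply: (@L2_bounded_fun _ _ _ _ _ _ `|Theta0|) => //.
  exact: lebesgue_bounded_lty.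
have := L2B mO (L2_strain u i j) (L2Z mO (aL * (1%:M : 'M[R]_d) i j) (L2B mO Theta_L2 T2)).
by congr L2; apply/funext => x; rewrite !mxE /=; ring.
Qed.

Lemma thermal_strain_add u v :
  tstrain (u + v) = fun x => 1 *: strain v x + tstrain u x.
Proof. by apply/funext => x; apply/matrixP => i j; rewrite !mxE /=; ring. Qed.

Lemma stressE u x : stress lambda mu u x = hooke lambda mu (strain u x).
Proof.
rewrite /stress /hooke; congr (_ *: _ + _); congr (_ * _).
by apply: eq_bigr => i _; rewrite mxE; lra.
Qed.

(** The constant beta = aL (d lambda + 2 mu) is what makes the thermal stress the
    image of the thermal strain under Hooke's law. *)
Lemma thermal_stressE u x :
  thermal_stress lambda mu aL Theta0 Theta u x = hooke lambda mu (tstrain u x).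
Proof.
rewrite /thermal_stress stressE /hooke /thermal_strain /beta.
rewrite linearB /= mxtraceZ mxtrace1.
by apply/matrixP => i j; rewrite !mxE; ring.
Qed.

Definition strain_form u v : R := elastic_form (strain u) (strain v).

Lemma strain_form_ZDl (c : R) u v w :
  strain_form (c *: u + v) w = c * strain_form u w + strain_form v w.
Proof.
rewrite /strain_form strain_ZD.
by apply: elastic_form_ZDl; exact: L2_strain.
Qed.

Lemma elastic_energyE u :
  elastic_energy lambda mu aL Theta0 Theta u = 2^-1 * elastic_form (tstrain u) (tstrain u).
Proof. by congr (_ * _); apply: eq_Rintegral => x _; rewrite thermal_stressE. Qed.

Lemma thermal_workE u v :
  \int[leb]_(x in Omega) ddot (thermal_stress lambda mu aL Theta0 Theta u x) (strain v x) =
  elastic_form (tstrain u) (strain v).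
Proof. by apply: eq_Rintegral => x _; rewrite thermal_stressE. Qed.

Lemma elastic_form_thermal_add u v A : L2_matrix A ->
  elastic_form (tstrain (u + v)) A =
  elastic_form (tstrain u) A + elastic_form (strain v) A.
Proof.
move=> A2; rewrite thermal_strain_add.
rewrite (elastic_form_ZDl 1 (L2_strain v) (L2_thermal_strain u) A2).
by rewrite mul1r addrC.
Qed.

(** The energy is half the quadratic form at the thermal strain, which is affine in
    the displacement: its linear part in v is the left-hand side of the weak
    equation. *)
Lemma elastic_energy_add u v :
  elastic_energy lambda mu aL Theta0 Theta (u + v) =
  elastic_energy lambda mu aL Theta0 Theta u + elastic_form (tstrain u) (strain v) +
  2^-1 * strain_form v v.
Proof.
have add := elastic_form_thermal_add u v.
rewrite !elastic_energyE add; last exact: L2_thermal_strain.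
rewrite (elastic_formC (tstrain u) (tstrain (u + v))) add; last exact: L2_thermal_strain.
rewrite (elastic_formC (strain v) (tstrain (u + v))) add; last exact: L2_strain.
rewrite (elastic_formC (strain v) (tstrain u)) /strain_form; lra.
Qed.

Hypotheses (d_gt0 : (0 < d)%N) (mu_gt0 : 0 < mu) (lambda_gt : - (2 * mu / d%:R) < lambda).
Local Notation alpha := (Num.min (2 * mu) (2 * mu + d%:R * lambda)).

Lemma elastic_form_ge0 A : 0 <= elastic_form A A.
Proof.
apply: Rintegral_ge0 => x _; apply: le_trans (hooke_elliptic _ d_gt0 lambda_gt).
by rewrite mulr_ge0 ?ddot_ge0// ltW// hooke_elliptic_const.
Qed.

Lemma strain_form_ge0 u : 0 <= strain_form u u.
Proof. exact: elastic_form_ge0. Qed.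

Lemma elastic_form_cauchy_schwarz A B : L2_matrix A -> L2_matrix B ->
  elastic_form A B ^+ 2 <= elastic_form A A * elastic_form B B.
Proof.
move=> A2 B2; apply: sqr_le_of_quadratic_ge0 => t.
have := elastic_form_ge0 (fun x => t *: B x + A x).
have tBA : L2_matrix (fun x => t *: B x + A x).
  move=> i j; have := L2_ZD mO t (B2 i j) (A2 i j).
  by congr L2; apply/funext => x; rewrite !mxE.
rewrite elastic_form_ZDl// !(elastic_formC _ (fun x => t *: B x + A x)).
rewrite !elastic_form_ZDl// (elastic_formC B A).
by move=> /le_trans; apply; rewrite le_eqVlt; apply/orP; left; apply/eqP; ring.
Qed.

Lemma strain_form_coercive v :
  alpha * \int[leb]_(x in Omega) ddot (strain v x) (strain v x) <= strain_form v v.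
Proof.
have sv := L2_strain v; have iv := integrable_ddot sv sv.
rewrite -(RintegralZl alpha mO iv).
apply: (le_Rintegral mO (integrableZl mO alpha iv) (integrable_elastic sv sv)).
by move=> x _; exact: hooke_elliptic.
Qed.

Lemma strain_form_bounded v :
  strain_form v v <= (d%:R * `|lambda| + 2 * mu) * \sum_i H1_sqnorm (v i).
Proof.
set c := _ + _; have c0 : 0 <= c by rewrite addr_ge0 ?mulr_ge0// ltW.
have sv := L2_strain v.
pose Dv x : 'M[R]_d := \matrix_(i, j) H1_grad (v i) j x.
have Dv2 : L2_matrix Dv.
  by move=> i j; have := H1_grad_L2 (v i) j; congr L2; apply/funext => x; rewrite mxE.
have iD := integrable_ddot Dv2 Dv2.
apply: (@le_trans _ _ (c * \int[leb]_(x in Omega) ddot (Dv x) (Dv x))).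
  rewrite -(RintegralZl c mO iD).
  apply: (le_Rintegral mO (integrable_elastic sv sv) (integrableZl mO c iD)).
  move=> x _; apply: le_trans (hooke_bounded _ _ mu_gt0) _.
  rewrite ler_wpM2l//; have := ddot_sym_part_le (Dv x); congr (_ <= _).
  by congr ddot; apply/matrixP => i j; rewrite !mxE.
rewrite ler_wpM2l// /ddot.
rewrite (_ : \int[leb]_(x in Omega) _ =
    \sum_i \sum_j \int[leb]_(x in Omega) (H1_grad (v i) j x ^+ 2)).
  apply: ler_sum => i _; rewrite lerDr.
  by apply: Rintegral_ge0 => x _; exact: sqr_ge0.
have iDij i j := L2_integrableM mO (Dv2 i j) (Dv2 i j).
rewrite (Rintegral_big mO); last by move=> i; exact: (integrable_big mO).
apply: eq_bigr => i _; rewrite (Rintegral_big mO)//.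
by apply: eq_bigr => j _; apply: eq_Rintegral => x _; rewrite !mxE.
Qed.

End ElasticForm.

(** * Existence, uniqueness and minimality *)

Section Admissible.
Context (R : realType) (d : nat) (Omega GammaD : set 'rV[R]_d).
Context (gamma : ('rV[R]_d -> R) -> 'rV[R]_d -> R).
Context (oO : open Omega) (bO : bounded_set Omega).
Hypothesis (trace_gamma : trace_operator Omega gamma).
Hypothesis (korn_ineq : korn Omega gamma).
Hypothesis (mGD : measurable (GammaD : set (caratheodory_type (hausdorff_outer d.-1)))).
Hypothesis (mbO : measurable (boundary Omega : set (caratheodory_type (hausdorff_outer d.-1)))).
Hypothesis (GDO : GammaD `<=` boundary Omega).
Hypothesis (GD_pos : (0 < surface R d GammaD)%E).
Variables (lambda mu : R).
Hypotheses (d_gt0 : (0 < d)%N) (mu_gt0 : 0 < mu) (lambda_gt : - (2 * mu / d%:R) < lambda).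
Local Notation field := ('I_d -> H1_space oO bO).
Local Notation V0 := (V gamma GammaD (fun _ _ => 0) : set field).
Implicit Types u v w : field.

Lemma V0_ZD (c : R) u v : V0 u -> V0 v -> V0 (c *: u + v).
Proof.
move=> u0 v0; have := V_ZD trace_gamma c GDO u0 v0.
by congr V; apply/funext => i; apply/funext => x; rewrite mulr0 addr0.
Qed.

Lemma V_add_V0 (f : 'I_d -> 'rV[R]_d -> R) u v :
  V gamma GammaD f u -> V0 v -> V gamma GammaD f (u + v).
Proof.
move=> uf v0; have := V_ZD trace_gamma 1 GDO v0 uf; rewrite scale1r addrC.
by congr V; apply/funext => i; apply/funext => x; rewrite mulr0 add0r.
Qed.

Lemma V_sub (f : 'I_d -> 'rV[R]_d -> R) u v :
  V gamma GammaD f u -> V gamma GammaD f v -> V0 (v - u).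
Proof.
move=> uf vf; have := V_ZD trace_gamma (-1) GDO uf vf; rewrite scaleN1r addrC.
by congr V; apply/funext => i; apply/funext => x; rewrite mulN1r addNr.
Qed.

(** Korn's inequality combined with the ellipticity of Hooke's law.  The absolute
    value covers a nonpositive Korn constant. *)
Lemma H1_sqnorm_le_strain_form :
  exists k : R, forall v, V0 v -> \sum_i H1_sqnorm (v i) <= k * strain_form lambda mu v v.
Proof.
have [C kornC] := korn_ineq GDO mGD GD_pos.
have a0 := hooke_elliptic_const d_gt0 mu_gt0 lambda_gt.
exists (`|C| / Num.min (2 * mu) (2 * mu + d%:R * lambda)) => v v0.
have coer := strain_form_coercive d_gt0 lambda_gt v.
apply: le_trans (kornC v v0) _; rewrite -mulrA.
set s := \int[_]_(x in _) _ in coer *.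
have s0 : 0 <= s by apply: Rintegral_ge0 => x _; exact: ddot_ge0.
apply: (@le_trans _ _ (`|C| * s)); first by rewrite ler_wpM2r// ler_norm.
by rewrite ler_wpM2l// ler_pdivlMl.
Qed.

(** Coercivity turns the form estimate into an H^1 estimate, H^1 is complete, the
    trace condition is closed, and boundedness of the form brings the convergence
    back. *)
Lemma V0_complete (v : nat -> field) (C : R) : (forall n, V0 (v n)) ->
  (forall n k, (n <= k)%N -> strain_form lambda mu (v n - v k) (v n - v k) <= C / 4 ^+ n) ->
  exists u, V0 u /\
    exists C', forall n, strain_form lambda mu (v n - u) (v n - u) <= C' / 4 ^+ n.
Proof.
move=> v0 vC; have [k vk] := H1_sqnorm_le_strain_form.
have H1C i n m : (n <= m)%N -> H1_sqnorm (v n i - v m i) <= (`|k| * C) / 4 ^+ n.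
  move=> nm; have vnm : V0 (v n - v m).
    by rewrite addrC -scaleN1r; exact: V0_ZD.
  have a0 := strain_form_ge0 d_gt0 mu_gt0 lambda_gt (v n - v m).
  apply: (@le_trans _ _ (\sum_j H1_sqnorm ((v n - v m) j))).
    rewrite (bigD1 i)//= lerDl; apply: sumr_ge0 => j _; exact: H1_sqnorm_ge0.
  apply: le_trans (vk _ vnm) _; rewrite -mulrA.
  apply: (@le_trans _ _ (`|k| * strain_form lambda mu (v n - v m) (v n - v m))).
    by rewrite ler_wpM2r// ler_norm.
  by rewrite ler_wpM2l// vC.
have /choice[u uP] i := H1_complete (H1C i).
exists u; split.
  by move=> i; apply: (trace0_closed trace_gamma mGD mbO GDO _ (uP i)) => n; exact: v0.
pose c := d%:R * `|lambda| + 2 * mu.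
exists (c * (d%:R * (d.+1%:R * (`|k| * C)))) => n.
apply: le_trans (strain_form_bounded lambda mu_gt0 _) _; rewrite -mulrA ler_wpM2l//.
  by rewrite addr_ge0 ?mulr_ge0// ltW.
apply: (@le_trans _ _ (\sum_(i < d) (d.+1%:R * (`|k| * C)) / 4 ^+ n)).
  by apply: ler_sum => i _; exact: uP.
by rewrite sumr_const card_ord -[leLHS]mulr_natl mulrA.
Qed.

(** By coercivity the difference has norm 0 in H^1, so it vanishes almost
    everywhere. *)
Lemma strain_form_eq0 u v : V0 (u - v) ->
  strain_form lambda mu (u - v) (u - v) <= 0 -> H1_eq u v.
Proof.
move=> uv0 a0 i; have [k /(_ _ uv0) uvk] := H1_sqnorm_le_strain_form.
have mO := lebesgue_measurable_open oO.
have a0' := strain_form_ge0 d_gt0 mu_gt0 lambda_gt (u - v).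
have {a0 a0'}a0 : strain_form lambda mu (u - v) (u - v) = 0.
  by apply/eqP; rewrite eq_le a0.
have uv2 : \int[lebesgueRn R d]_(x in Omega) ((u i x - v i x) ^+ 2) = 0.
  apply/eqP; rewrite eq_le Rintegral_ge0 ?andbT; last by move=> x _; exact: sqr_ge0.
  apply: le_trans (H1_val_sqdist_le _ _) _; rewrite -H1_sqnormB.
  rewrite a0 mulr0 in uvk; apply: le_trans uvk; rewrite (bigD1 i)//= lerDl.
  by apply: sumr_ge0 => j _; exact: H1_sqnorm_ge0.
have := L2_ae0 mO (L2B mO (H1_val_L2 (u i)) (H1_val_L2 (v i))) uv2.
have F := ae_filter_ringOfSetsType (lebesgueRn R d).
by apply: filterS => x + Ox => /(_ Ox)/eqP; rewrite subr_eq0 => /eqP.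
Qed.

End Admissible.

Theorem proposition2p3 (R : realType) (d : nat) (hd : d = 2%N \/ d = 3%N)
  (Omega : set 'rV[R]_d) (GammaD GammaN : set 'rV[R]_d)
  (gamma : ('rV[R]_d -> R) -> 'rV[R]_d -> R)
  (Omega_neq0 : Omega !=set0) (Omega_open : open Omega)
  (Omega_connected : connected Omega) (Omega_bounded : bounded_set Omega)
  (Gamma_cover : boundary Omega = GammaD `|` GammaN)
  (Gamma_disj : GammaD `&` GammaN = set0)
  (GammaD_meas :
    measurable (GammaD : set (caratheodory_type (hausdorff_outer d.-1))))
  (GammaN_meas :
    measurable (GammaN : set (caratheodory_type (hausdorff_outer d.-1))))
  (GammaD_pos : (0 < surface R d GammaD)%E)
  (trace_theory : trace_operator Omega gamma)
  (korn_ineq : korn Omega gamma)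
  (lambda mu aL Theta0 : R)
  (mu_gt0 : 0 < mu) (lambda_gt : - (2 * mu / d%:R) < lambda)
  (aL_gt0 : 0 < aL) (Theta0_gt0 : 0 < Theta0)
  (Theta : 'rV[R]_d -> R) (Theta_L2 : L2 (lebesgueRn R d) Omega Theta)
  (uD : 'I_d -> 'rV[R]_d -> R) (uD_trace : trace_space Omega gamma GammaD uD) :
  exists u : 'I_d -> H1 Omega,
    [/\ weak_solution gamma lambda mu aL Theta0 GammaD uD Theta u,
        forall w : 'I_d -> H1 Omega,
          weak_solution gamma lambda mu aL Theta0 GammaD uD Theta w ->
          H1_eq w u,
        minimizer gamma lambda mu aL Theta0 GammaD uD Theta u &
        forall w : 'I_d -> H1 Omega,
          minimizer gamma lambda mu aL Theta0 GammaD uD Theta w ->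
          H1_eq w u].
Proof.
have d_gt0 : (0 < d)%N by case: hd => ->.
have GDO : GammaD `<=` boundary Omega by rewrite Gamma_cover => x; left.
have mbO : measurable (boundary Omega : set (caratheodory_type (hausdorff_outer d.-1))).
  by rewrite Gamma_cover; exact: measurableU.
have [w wD] := uD_trace.
pose oO := Omega_open; pose bO := Omega_bounded.
pose field := 'I_d -> H1_space oO bO; pose w' : field := w.
pose V0 : set field := V gamma GammaD (fun _ _ => 0).
pose tstrain (u : field) := thermal_strain aL Theta0 Theta u.
pose a (u v : field) := strain_form lambda mu u v.
pose l (v : field) := - elastic_form Omega lambda mu (tstrain w') (strain v).
have tw2 := L2_thermal_strain aL Theta0 Theta_L2 w'.
have [v v0 av] : exists2 v, V0 v & forall phi, V0 phi -> a v phi = l phi.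
  apply: (@riesz_representation _ _ _ _ _ (elastic_form Omega lambda mu (tstrain w') (tstrain w'))).
  - exact: (V0_zero oO bO trace_theory GDO).
  - by move=> c u v; exact: V0_ZD.
  - by move=> u v; exact: elastic_formC.
  - by move=> c u v z; exact: strain_form_ZDl.
  - by move=> u; exact: elastic_form_ge0.
  - move=> c u v; rewrite /l !(elastic_formC _ _ _ (tstrain w')) strain_ZD.
    rewrite (elastic_form_ZDl oO lambda mu c (L2_strain u) (L2_strain v) tw2).
    by rewrite opprD mulrN.
  - exact: elastic_form_ge0.
  - move=> u; rewrite /l sqrrN.
    exact: (elastic_form_cauchy_schwarz oO d_gt0 mu_gt0 lambda_gt tw2 (L2_strain u)).
  - by move=> vn C; exact: V0_complete.
pose u : field := w' + v.
have uD_u : V gamma GammaD uD u by exact: V_add_V0.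
have weak_u phi : V0 phi -> elastic_form Omega lambda mu (tstrain u) (strain phi) = 0.
  move=> phi0.
  rewrite (elastic_form_thermal_add lambda mu aL Theta0 Theta_L2 w' v (L2_strain phi)).
  by rewrite -/(strain_form lambda mu v phi) -/(a v phi) (av _ phi0) /l addrN.
(* every admissible field is u + phi with phi in V0, and its energy exceeds that of u
   by half the form at phi *)
have energy_u (z : field) : V gamma GammaD uD z ->
    elastic_energy lambda mu aL Theta0 Theta z =
    elastic_energy lambda mu aL Theta0 Theta u + 2^-1 * a (z - u) (z - u).
  move=> zD; have zu0 : V0 (z - u) by exact: V_sub uD_u zD.
  rewrite -{1}(subrK u z) (addrC (z - u)) (elastic_energy_add _ _ _ _ Theta_L2).
  by rewrite (weak_u _ zu0) addr0.
exists u; split.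
- split => // phi phi0.
  by rewrite thermal_workE; exact: weak_u.
- move=> z [zD z_weak]; have zu0 : V0 ((z : field) - u) by exact: V_sub uD_u zD.
  apply: (strain_form_eq0 korn_ineq GammaD_meas GDO GammaD_pos d_gt0 mu_gt0 lambda_gt zu0).
  have := z_weak _ zu0; rewrite thermal_workE -{1}(subrK u z) (addrC (_ - u)).
  rewrite (elastic_form_thermal_add _ _ _ _ Theta_L2 _ _ (L2_strain _)).
  by rewrite (weak_u _ zu0) add0r => h; rewrite /strain_form h.
- split => // z zD; rewrite (energy_u z zD) lerDl mulr_ge0//.
  exact: elastic_form_ge0.
- move=> z [zD z_min]; have zu0 : V0 ((z : field) - u) by exact: V_sub uD_u zD.
  apply: (strain_form_eq0 korn_ineq GammaD_meas GDO GammaD_pos d_gt0 mu_gt0 lambda_gt zu0).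
  have := z_min _ uD_u; rewrite (energy_u z zD) /a; lra.
Qed.
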